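(* Let $\nu$ be a prime polynomial in $R_\infty=\mathbb{F}_q[Y]$ and let $x_0\in X_\infty$ be an $A_\infty$-periodic point. There exists $c>0$ such that every rational $\xi\in\Omega$ has uniform $c$-escape of mass.
   Context: Let $q$ be a positive power of a prime $p$, $K=\mathbb{F}_q(Y)$, $R_\infty=\mathbb{F}_q[Y]$, $K_\infty=\mathbb{F}_q((Y^{-1}))$, and $X_\infty=\mathrm{PGL}_2(K_\infty)/\mathrm{PGL}_2(R_\infty)$. Via $g\,\mathrm{PGL}_2(R_\infty)\mapsto [g(R_\infty\times R_\infty)]$, the space $X_\infty$ is the space of homothety classes (under $K_\infty^\times$) of $R_\infty$-lattices in $K_\infty\times K_\infty$, i.e. rank $2$ free $R_\infty$-submodules spanning $K_\infty\times K_\infty$ over $K_\infty$. Let $A_\infty$ be the diagonal subgroup of $\mathrm{PGL}_2(K_\infty)$, acting on $X_\infty$ on the left. A point $x\in X_\infty$ is $A_\infty$-periodic if its orbit $A_\infty x$ is compact; $\mu_x$ then denotes the unique $A_\infty$-invariant probability measure on $A_\infty x$. For a prime polynomial $\nu\in R_\infty$, let $K_\nu$ be the completion of $K$ at $\nu$ and $O_\nu$ its valuation ring. The Hecke tree $T_\nu(x_0)$ is the connected component of $x_0$ in the graph with vertex set $X_\infty$, with an edge between two classes whenever they have representatives $\Lambda,\Lambda'$ with $\Lambda'\subset\Lambda$ and $\Lambda/\Lambda'\cong R_\infty/\nu R_\infty$ as $R_\infty$-modules. It is a regular tree. Let $\Omega$ be its boundary at infinity (set of ends). For $\xi\in\Omega$,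 $(x_n^\xi)_{n\in\mathbb{N}}$ denotes the sequence of vertices along the geodesic ray in $T_\nu(x_0)$ from $x_0$ to $\xi$. If $x_0$ is $A_\infty$-periodic, all vertices of $T_\nu(x_0)$ are $A_\infty$-periodic. $\Omega$ identifies with $\mathbb{P}^1(K_\nu)$ as follows: choose $g\in \mathrm{GL}_2(K_\infty)$ with $x_0=[g(R_\infty^2)]$; to $[a:b]\in\mathbb{P}^1(K_\nu)$ with $a,b\in O_\nu$ not both in $\nu O_\nu$, associate the end of the ray $n\mapsto [g(L_n)]$, where $L_n=R_\infty^2\cap\big(O_\nu\,(a,b)+\nu^nO_\nu^2\big)$. A point of $\Omega$ is rational if it corresponds to a point of $\mathbb{P}^1(K)$; this does not depend on the choice of $g$. For $\xi\in\Omega$, $\Theta_\xi$ is the set of weak-star accumulation points (tested against continuous functions with compact support) of the sequence of measures $(\mu_{x_n^\xi})_{n\in\mathbb{N}}$ on $X_\infty$. For $c>0$, $\xi$ has uniform $c$-escape of mass if every $\theta\in\Theta_\xi$ satisfies $\theta(X_\infty)\le 1-c$. *)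

(* Defs.v *)
From HB Require Import structures.
From mathcomp Require Import all_boot all_order all_algebra.
From mathcomp Require Import all_classical all_reals all_analysis.
From mathcomp Require Import ring_quotient.
From mathcomp Require Import ring.

Set Implicit Arguments.
Unset Strict Implicit.
Unset Printing Implicit Defensive.
Import Order.TTheory GRing.Theory Num.Theory.
Import numFieldNormedType.Exports.
Local Open Scope classical_set_scope.
Local Open Scope ring_scope.
Local Open Scope quotient_scope.

Local Notation "x %:F" := (@FracField.tofrac _ x).

(* [pseries F] is F[[T]]; [pcoef f n] is the coefficient of T^n. *)
Record pseries (F : Type) := PSeries { pcoef : nat -> F }.

Section PowerSeries.
Variable F : fieldType.
Implicit Types f g h : pseries F.

HB.instance Definition _ := gen_eqMixin (pseries F).
HB.instance Definition _ := gen_choiceMixin (pseries F).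

Lemma pseriesP f g : (forall n, pcoef f n = pcoef g n) -> f = g.
Proof. by case: f g => [f] [g] /= fg; congr PSeries; apply/funext. Qed.

Definition ps_zero : pseries F := PSeries (fun=> 0).
Definition ps_one : pseries F := PSeries (fun n => (n == 0)%:R).
Definition ps_opp f := PSeries (fun n => - pcoef f n).
Definition ps_add f g := PSeries (fun n => pcoef f n + pcoef g n).
Definition ps_mul f g :=
  PSeries (fun n => \sum_(i < n.+1) pcoef f i * pcoef g (n - i)).

Fact ps_addA : associative ps_add.
Proof. by move=> f g h; apply: pseriesP => n /=; rewrite addrA. Qed.
Fact ps_addC : commutative ps_add.
Proof. by move=> f g; apply: pseriesP => n /=; rewrite addrC. Qed.
Fact ps_add0 : left_id ps_zero ps_add.
Proof. by move=> f; apply: pseriesP => n /=; rewrite add0r. Qed.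
Fact ps_addN : left_inverse ps_zero ps_opp ps_add.
Proof. by move=> f; apply: pseriesP => n /=; rewrite addNr. Qed.

HB.instance Definition _ :=
  GRing.isZmodule.Build (pseries F) ps_addA ps_addC ps_add0 ps_addN.

Definition ps_trunc m f : {poly F} := \poly_(i < m) pcoef f i.

Lemma ps_truncE m f i : (i < m)%N -> (ps_trunc m f)`_i = pcoef f i.
Proof. by move=> im; rewrite coef_poly im. Qed.

Lemma ps_mulE m f g n : (n < m)%N -> pcoef (ps_mul f g) n = (ps_trunc m f * ps_trunc m g)`_n.
Proof.
move=> nm; rewrite coefM; apply: eq_bigr => i _.
by rewrite !ps_truncE //; [exact: leq_ltn_trans (leq_subr _ _) nm |
  exact: leq_trans (ltn_ord i) nm].
Qed.

Fact ps_mulA : associative ps_mul.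
Proof.
move=> f g h; apply: pseriesP => n.
have trM a b i : (i < n.+1)%N -> (ps_trunc n.+1 (ps_mul a b))`_i = (ps_trunc n.+1 a * ps_trunc n.+1 b)`_i.
  by move=> i_n; rewrite ps_truncE // (@ps_mulE n.+1).
rewrite !(@ps_mulE n.+1) //.
transitivity ((ps_trunc n.+1 f * (ps_trunc n.+1 g * ps_trunc n.+1 h))`_n).
  rewrite !coefM; apply: eq_bigr => i _; rewrite trM //.
  by rewrite ltnS leq_subr.
rewrite mulrA !coefM; apply: eq_bigr => i _; rewrite trM //.
Qed.

Fact ps_mulC : commutative ps_mul.
Proof. by move=> f g; apply: pseriesP => n; rewrite !(@ps_mulE n.+1) // mulrC. Qed.

Fact ps_mul1 : left_id ps_one ps_mul.
Proof.
move=> f; apply: pseriesP => n /=; rewrite big_ord_recl /= subn0 mul1r.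
by rewrite big1 ?addr0 // => i _; rewrite mul0r.
Qed.

Fact ps_mulD : left_distributive ps_mul ps_add.
Proof.
move=> f g h; apply: pseriesP => n /=; rewrite -big_split.
by apply: eq_bigr => i _; rewrite mulrDl.
Qed.

Fact ps_1neq0 : ps_one != ps_zero.
Proof. by apply/eqP => /(congr1 (fun f => pcoef f 0)) /eqP; rewrite /= oner_eq0. Qed.

HB.instance Definition _ := GRing.Zmodule_isComNzRing.Build (pseries F)
  ps_mulA ps_mulC ps_mul1 ps_mulD ps_1neq0.

(* Inverses are obtained by choice; only the field of fractions is used below. *)
Definition ps_unit : {pred pseries F} := fun f => `[< exists g, g * f = 1 >].
Definition ps_inv f := if f \in ps_unit then xget f [set g | g * f = 1] else f.

Fact ps_mulVr : {in ps_unit, left_inverse 1 ps_inv *%R}.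
Proof.
move=> f uf; rewrite /ps_inv uf; case: xgetP => [g _ //|] none.
by have /asboolP[g gf] := uf; case: (none g).
Qed.
Fact ps_unitPl f g : g * f = 1 -> ps_unit f.
Proof. by move=> gf; apply/asboolP; exists g. Qed.
Fact ps_inv_out : {in [predC ps_unit], ps_inv =1 id}.
Proof. by move=> f; rewrite inE /= /ps_inv => /negbTE ->. Qed.

HB.instance Definition _ := GRing.ComNzRing_hasMulInverse.Build (pseries F)
  ps_mulVr ps_unitPl ps_inv_out.

Lemma ps_ord f : f != 0 -> exists n, pcoef f n != 0 /\ forall i, (i < n)%N -> pcoef f i = 0.
Proof.
move=> f0; have ex : exists n, pcoef f n != 0.
  apply: contrapT => /forallNP nf; case/eqP: f0; apply: pseriesP => n.
  by apply/eqP/negPn/negP; exact: nf.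
exists (ex_minn ex); case: ex_minnP => n fn0 nmin; split=> // i i_n.
by apply/eqP; apply: contraTT i_n; rewrite -leqNgt => /nmin.
Qed.

Fact ps_idomain : GRing.integral_domain_axiom (pseries F).
Proof.
move=> f g fg0; apply/norP => -[/ps_ord[n [fn fi]] /ps_ord[m [gm gi]]].
have /eqP := congr1 (fun f => pcoef f (n + m)%N) fg0; rewrite /=.
have nlt : (n < (n + m).+1)%N by rewrite ltnS leq_addr.
rewrite (bigD1 (Ordinal nlt)) //= big1 ?addr0.
  by rewrite addKn mulf_eq0 (negPf fn) (negPf gm).
move=> i ni; case: (ltngtP i n) => [/fi ->|n_i|e]; first by rewrite mul0r.
  rewrite gi ?mulr0 // ltn_subLR ?ltn_add2r //.
  by rewrite -ltnS.
by case/eqP: ni; apply: val_inj.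
Qed.

HB.instance Definition _ :=
  GRing.ComUnitRing_isIntegral.Build (pseries F) ps_idomain.

Definition psX : pseries F := PSeries (fun n => (n == 1)%:R).
Definition psC (c : F) : pseries F := PSeries (fun n => c *+ (n == 0)).

Fact psC_zmod : zmod_morphism psC.
Proof. by move=> a b; apply: pseriesP => n /=; rewrite mulrnBl. Qed.
Fact psC_monoid : monoid_morphism psC.
Proof.
split=> [|a b]; apply: pseriesP => n /=; first by [].
rewrite big_ord_recl /= subn0 big1 ?addr0; last first.
  by move=> i _; rewrite /= mulr0n mul0r.
by case: n => [|n]; rewrite /= ?mulr1n // !mulr0n mulr0.
Qed.
HB.instance Definition _ := GRing.isZmodMorphism.Build F (pseries F) psC psC_zmod.
HB.instance Definition _ := GRing.isMonoidMorphism.Build F (pseries F) psC psC_monoid.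

End PowerSeries.

(* F((T)) as Frac F[[T]]. Below T = psX stands for Y^-1, so that [laurent F] is
   F((Y^-1)), and {poly F} is F[Y]. *)
Definition laurent (F : fieldType) := {fraction (pseries F)}.
HB.instance Definition _ (F : fieldType) := GRing.Field.on (laurent F).

Section AdicCompletion.
Variables (F : fieldType) (nu : {poly F}) (nu_irr : irreducible_poly nu).

Local Notation K := {fraction {poly F}}.
Implicit Types (x y : K) (u w : nat -> K).

(* v_nu(x) >= n, for the nu-adic valuation of the field of fractions F(Y) *)
Definition adic_ge (n : nat) x := exists a b : {poly F},
  ~~ (nu %| b) /\ x = (nu ^+ n * a)%:F / b%:F.

Lemma adic_nu_neq0 : nu != 0.
Proof. by apply: contraTneq nu_irr.1 => ->; rewrite size_poly0. Qed.

Lemma adic_nuF_neq0 : nu%:F != 0 :> K. Proof. by rewrite tofrac_eq0 adic_nu_neq0. Qed.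

Lemma adic_coprime a : ~~ (nu %| a) -> coprimep nu a.
Proof.
move=> na; rewrite /coprimep; apply: contraNT na => g1.
have := nu_irr.2 (gcdp nu a) g1 (dvdp_gcdl _ _).
by move=> /eqp_dvdl <-; exact: dvdp_gcdr.
Qed.

Lemma adic_prime a b : ~~ (nu %| a) -> ~~ (nu %| b) -> ~~ (nu %| a * b).
Proof. by move=> /adic_coprime na; apply: contra; rewrite Gauss_dvdpr. Qed.

Lemma adic_ndvd_neq0 b : ~~ (nu %| b) -> b%:F != 0 :> K.
Proof. by apply: contraNneq => /eqP; rewrite tofrac_eq0 => /eqP ->; exact: dvdp0. Qed.

Lemma adic_ndvd1 : ~~ (nu %| 1).
Proof. by rewrite dvdp1; apply: contraTneq nu_irr.1 => ->. Qed.

#[local] Hint Resolve adic_ndvd1 : core.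

Lemma adic_ge_add n x y : adic_ge n x -> adic_ge n y -> adic_ge n (x + y).
Proof.
move=> [a [b [nb ->]]] [c [d [nd ->]]]; exists (a * d + c * b), (b * d).
split; first exact: adic_prime.
rewrite addf_div ?adic_ndvd_neq0 // -!tofracM -tofracD; congr (_ / _); congr tofrac.
by rewrite mulrDr !mulrA.
Qed.

Lemma adic_ge_opp n x : adic_ge n x -> adic_ge n (- x).
Proof.
move=> [a [b [nb ->]]]; exists (- a), b; split=> //.
by rewrite mulrN tofracN mulNr.
Qed.

Lemma adic_ge_sub n x y : adic_ge n x -> adic_ge n y -> adic_ge n (x - y).
Proof. by move=> xn yn; apply: adic_ge_add => //; exact: adic_ge_opp. Qed.

Lemma adic_ge0 n : adic_ge n 0.
Proof. by exists 0, 1; rewrite mulr0 tofrac0 mul0r. Qed.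

Lemma adic_ge1 : ~ adic_ge 1 1.
Proof.
move=> [a [b [nb]]] /esym /eqP; rewrite -[X in _ == X]divr1 -tofrac1.
rewrite eqr_div ?adic_ndvd_neq0 // -!tofracM tofrac_eq mulr1 mul1r => /eqP e.
by move: nb; rewrite -e dvdp_mulr.
Qed.

Lemma adic_ge_mul n m x y : adic_ge n x -> adic_ge m y -> adic_ge (n + m) (x * y).
Proof.
move=> [a [b [nb ->]]] [c [d [nd ->]]]; exists (a * c), (b * d).
split; first exact: adic_prime.
by rewrite mulf_div -!tofracM mulrACA exprD.
Qed.

Lemma adic_ge_le n m x : (m <= n)%N -> adic_ge n x -> adic_ge m x.
Proof.
move=> mn [a [b [nb ->]]]; exists (nu ^+ (n - m) * a), b; split=> //.
by rewrite mulrA -exprD subnKC.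
Qed.

Lemma adic_shift n m x : adic_ge (m + n) (nu%:F ^+ n * x) -> adic_ge m x.
Proof.
move=> [a [b [nb e]]]; exists a, b; split=> //.
apply: (mulfI (expf_neq0 n adic_nuF_neq0)); rewrite e mulrA; congr (_ / _).
by rewrite -tofracXn -tofracM mulrA -exprD addnC.
Qed.

Lemma adic_factor a : a != 0 -> exists k b, ~~ (nu %| b) /\ a = nu ^+ k * b.
Proof.
have [m] := ubnP (size a); elim: m a => // m IH a am a0.
have [/dvdpP[c ac]|na] := boolP (nu %| a); last by exists 0%N, a; rewrite mul1r.
have c0 : c != 0 by apply: contraNneq a0 => c0; rewrite ac c0 mul0r.
have [|k [b [nb cb]]] := IH c _ c0; last first.
  by exists k.+1, b; split=> //; rewrite ac cb mulrAC exprSr.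
rewrite -ltnS (leq_trans _ am) // ltnS ac size_mul ?adic_nu_neq0 //.
by have := nu_irr.1; case: (size nu) => [|[|l]] // _; rewrite !addnS /= ltnS leq_addr.
Qed.

Lemma fraction_cancel (c a b : {poly F}) :
  c != 0 -> (c * a)%:F / (c * b)%:F = a%:F / b%:F :> K.
Proof.
move=> c0; rewrite !(tofracM c) -mulf_div divff; first by rewrite mul1r.
by rewrite tofrac_eq0.
Qed.

Lemma fraction_polyE x : exists a b : {poly F}, b != 0 /\ x = a%:F / b%:F.
Proof.
elim/quotW: x => r; exists (frac r).1, (frac r).2; have dr := denom_ratioP r; split=> //.
have dF : ((frac r).2)%:F != 0 :> K by rewrite tofrac_eq0.
apply: (canRL (mulfK dF)); rewrite /GRing.mul /=; unlock FracField.tofrac.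
rewrite -FracField.pi_mul; apply/eqmodP.
rewrite /= FracField.equivfE /FracField.mulf.
rewrite !numden_Ratio ?oner_neq0 ?mulf_neq0 ?oner_neq0 //.
by rewrite !mulr1 mulrC.
Qed.

Lemma adic_or x : adic_ge 0 x \/ adic_ge 0 x^-1.
Proof.
have [a [b [b0 ->]]] := fraction_polyE x.
have [->|a0] := eqVneq a 0; first by left; rewrite tofrac0 mul0r; exact: adic_ge0.
have [k [a' [na ->]]] := adic_factor a0; have [l [b' [nb ->]]] := adic_factor b0.
have nuX n : nu ^+ n != 0 by apply: expf_neq0; exact: adic_nu_neq0.
have [lk|/ltnW kl] := leqP l k.
  left; exists (nu ^+ (k - l) * a'), b'; split; first exact: nb.
  by rewrite mul1r -{1}(subnKC lk) exprD -mulrA fraction_cancel.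
right; exists (nu ^+ (l - k) * b'), a'; split; first exact: na.
by rewrite invf_div mul1r -{1}(subnKC kl) exprD -mulrA fraction_cancel.
Qed.

Lemma adic_bound x : exists n, adic_ge 0 (nu%:F ^+ n * x).
Proof.
have [a [b [b0 ->]]] := fraction_polyE x; have [l [b' [nb ->]]] := adic_factor b0.
exists l, a, b'; split; first exact: nb.
rewrite mul1r mulrA -tofracXn -tofracM fraction_cancel //.
by apply: expf_neq0; exact: adic_nu_neq0.
Qed.

Definition adic_cauchy u := forall n, exists N, forall i j,
  (N <= i)%N -> (N <= j)%N -> adic_ge n (u i - u j).
Definition adic_null u := forall n, exists N, forall i, (N <= i)%N -> adic_ge n (u i).

Lemma adic_cauchy_bound u : adic_cauchy u ->
  exists m N, forall i, (N <= i)%N -> adic_ge 0 (nu%:F ^+ m * u i).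
Proof.
move=> /(_ 0%N)[N uN]; have [m um] := adic_bound (u N).
exists m, N => i Ni; rewrite -[u i](subrK (u N)) mulrDr; apply: adic_ge_add => //.
have -> : 0%N = (0 + 0)%N by []; apply: adic_ge_mul; last exact: uN.
by exists (nu ^+ m), 1; split=> //; rewrite mul1r tofrac1 divr1 tofracXn.
Qed.

(* The unused proof of irreducibility makes it available to the instances on the
   types built from the Cauchy sequences. *)
Definition cauchy_seqs of irreducible_poly nu : {pred nat -> K} :=
  fun u => `[< adic_cauchy u >].

Fact cauchy_subring : subring_closed (cauchy_seqs nu_irr).
Proof.
split=> [|u w /asboolP uc /asboolP wc|u w /asboolP uc /asboolP wc]; apply/asboolP.
- by move=> n; exists 0%N => i j _ _; rewrite subrr; exact: adic_ge0.
- move=> n; have [N uN] := uc n; have [M wM] := wc n.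
  exists (maxn N M) => i j; rewrite !geq_max => /andP[Ni Mi] /andP[Nj Mj].
  have -> : (u - w) i - (u - w) j = (u i - u j) - (w i - w j).
    by rewrite -[(u - w) i]/(u i - w i) -[(u - w) j]/(u j - w j); ring.
  by apply: adic_ge_sub; [exact: uN | exact: wM].
- have [m [A uA]] := adic_cauchy_bound uc; have [k [B wB]] := adic_cauchy_bound wc.
  move=> n; have [N uN] := uc (n + k)%N; have [M wM] := wc (n + m)%N.
  exists (maxn (maxn A B) (maxn N M)) => i j; rewrite !geq_max.
  move=> /andP[/andP[Ai Bi] /andP[Ni Mi]] /andP[/andP[Aj Bj] /andP[Nj Mj]].
  have -> : (u * w) i - (u * w) j = (u i - u j) * w i + u j * (w i - w j).
    by rewrite -[(u * w) i]/(u i * w i) -[(u * w) j]/(u j * w j); ring.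
  apply: adic_ge_add.
    apply: (@adic_shift k); rewrite mulrCA -[(n + k)%N]addn0.
    by apply: adic_ge_mul; [exact: uN | exact: wB].
  apply: (@adic_shift m); rewrite mulrA addnC -[(m + n)%N]add0n [(m + n)%N]addnC.
  by apply: adic_ge_mul; [exact: uA | exact: wM].
Qed.

HB.instance Definition _ := GRing.isSubringClosed.Build (nat -> K)
  (cauchy_seqs nu_irr) cauchy_subring.

Definition cauchy_ring := {u : nat -> K | u \in cauchy_seqs nu_irr}.
HB.instance Definition _ := SubChoice.on cauchy_ring.
HB.instance Definition _ := [SubChoice_isSubComNzRing of cauchy_ring by <:].

Definition cauchy_of u (uc : u \in cauchy_seqs nu_irr) : cauchy_ring :=
  exist (fun w => w \in cauchy_seqs nu_irr) u uc.

Definition null_seqs : {pred cauchy_ring} := fun s => `[< adic_null (\val s) >].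

Fact null_ideal : idealr_closed null_seqs.
Proof.
split; first by apply/asboolP => n; exists 0%N => i _; exact: adic_ge0.
  by apply/asboolP => /(_ 1%N)[N /(_ N (leqnn _))]; exact: adic_ge1.
move=> a u v /asboolP un /asboolP vn; apply/asboolP => n.
have /asboolP/adic_cauchy_bound[m [A aA]] := valP a.
have [N uN] := un (n + m)%N; have [M vM] := vn n.
exists (maxn A (maxn N M)) => i; rewrite !geq_max => /and3P[Ai Ni Mi].
rewrite rmorphD rmorphM; apply: adic_ge_add; last exact: vM.
apply: (@adic_shift m); rewrite mulrA addnC -[(m + n)%N]add0n [(m + n)%N]addnC.
by apply: adic_ge_mul; [exact: aA | exact: uN].
Qed.

HB.instance Definition _ := isIdealr.Build cauchy_ring null_seqs null_ideal.

(* The completion of F(Y) at nu: Cauchy sequences modulo null sequences. *)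
Definition adic_completion := {ideal_quot null_seqs}.
HB.instance Definition _ := GRing.ComNzRing.on adic_completion.
HB.instance Definition _ := EqQuotient.on adic_completion.

Lemma adic_null_inv u : adic_cauchy u -> ~ adic_null u -> exists n N, forall i,
  (N <= i)%N -> u i != 0 /\ adic_ge 0 (nu%:F ^+ n * (u i)^-1).
Proof.
move=> uc /existsNP[n /forallNP un]; have [N uN] := uc n; exists n, N => i Ni.
have nui : ~ adic_ge n (u i).
  move=> ui; apply: (un N) => j Nj; rewrite -(subrK (u i) (u j)).
  by apply: adic_ge_add => //; exact: uN.
have ui0 : u i != 0 by apply: contra_notN nui => /eqP ->; exact: adic_ge0.
split; [exact: ui0|]; have nuX : nu%:F ^+ n != 0 :> K := expf_neq0 n adic_nuF_neq0.
have [y0|] := adic_or ((nu%:F ^+ n)^-1 * u i); last by rewrite invfM invrK.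
case: nui; rewrite -(mulVKf nuX (u i)) -[n]addn0.
apply: adic_ge_mul; last by rewrite addn0.
by exists 1, 1; split=> //; rewrite addn0 mulr1 tofrac1 divr1 tofracXn.
Qed.

Lemma adic_inv_cauchy u : adic_cauchy u -> ~ adic_null u -> adic_cauchy (fun i => (u i)^-1).
Proof.
move=> uc /(adic_null_inv uc)[n [N uN]] k.
have [M uM] := uc (k + (n + n))%N; exists (maxn N M) => i j.
rewrite !geq_max => /andP[Ni Mi] /andP[Nj Mj].
have [[ui0 ui] [uj0 uj]] := (uN i Ni, uN j Nj).
have -> : (u i)^-1 - (u j)^-1 = (u j - u i) * ((u i)^-1 * (u j)^-1).
  rewrite mulrBl mulrCA (mulfV uj0) mulr1 (mulVKf ui0).
  reflexivity.
apply: (@adic_shift (n + n)); rewrite exprD mulrCA mulrACA -[(k + _)%N]addn0.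
by apply: adic_ge_mul; [exact: uM | rewrite -[0%N]addn0; exact: adic_ge_mul].
Qed.

Lemma adic_inv_seq_subproof (s : cauchy_ring) :
  (if s \in null_seqs then 0 else fun i => (\val s i)^-1) \in cauchy_seqs nu_irr.
Proof.
case: ifPn => [_|ns]; first exact: rpred0.
apply/asboolP/adic_inv_cauchy; first by have /asboolP := valP s.
by move=> sn; case/negP: ns; apply/asboolP.
Qed.

Definition adic_inv_seq (s : cauchy_ring) : cauchy_ring := cauchy_of (adic_inv_seq_subproof s).

Definition adic_inv (x : adic_completion) : adic_completion :=
  \pi_adic_completion (adic_inv_seq (repr x)).

Lemma adic_pi_null (s : cauchy_ring) : (\pi_adic_completion s == 0) = (s \in null_seqs).
Proof.
have -> : 0 = \pi_adic_completion 0 by rewrite piE.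
by rewrite -Quotient.idealrBE subr0.
Qed.

Fact adic_mulVf (x : adic_completion) : x != 0 -> adic_inv x * x = 1.
Proof.
rewrite -{1}[x]reprK adic_pi_null -{3}[x]reprK /adic_inv; move: (repr x) => s ns.
have -> : 1 = \pi_adic_completion 1 by rewrite piE.
rewrite -[LHS](@Quotient.pi_mul _ null_seqs); apply/eqP.
rewrite -Quotient.idealrBE; apply/asboolP => n.
have sc : adic_cauchy (\val s) by have /asboolP := valP s.
have sn : ~ adic_null (\val s) by move=> sn; case/negP: ns; apply/asboolP.
have [m [N sN]] := adic_null_inv sc sn; exists N => i /sN[si _].
rewrite rmorphB rmorphM rmorph1 /= (negPf ns).
rewrite -[X in adic_ge _ X]/((\val s i)^-1 * \val s i - 1) mulVf // subrr.
exact: adic_ge0.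
Qed.

Fact adic_inv0 : adic_inv 0 = 0.
Proof.
have /eqP := reprK (0 : adic_completion); rewrite adic_pi_null => n0.
apply/eqP; rewrite /adic_inv adic_pi_null.
have -> : adic_inv_seq (repr (0 : adic_completion)) = 0 :> cauchy_ring by apply: val_inj; rewrite /= n0.
exact: rpred0.
Qed.

HB.instance Definition _ :=
  GRing.ComNzRing_isField.Build adic_completion adic_mulVf adic_inv0.

Lemma adic_const_subproof x : (fun=> x) \in cauchy_seqs nu_irr.
Proof. by apply/asboolP => n; exists 0%N => i j _ _; rewrite subrr; exact: adic_ge0. Qed.

Definition adic_const x : cauchy_ring := cauchy_of (adic_const_subproof x).
Definition adic_embed x : adic_completion := \pi_adic_completion (adic_const x).

Fact adic_embed_zmod : zmod_morphism adic_embed.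
Proof.
move=> x y; rewrite /adic_embed.
have -> : adic_const (x - y) = adic_const x - adic_const y :> cauchy_ring.
  by apply: val_inj; rewrite rmorphB.
by rewrite rmorphB.
Qed.

Fact adic_embed_monoid : monoid_morphism adic_embed.
Proof.
split=> [|x y]; rewrite /adic_embed.
  have -> : adic_const 1 = 1 :> cauchy_ring by apply: val_inj; rewrite rmorph1.
  by rewrite rmorph1.
have -> : adic_const (x * y) = adic_const x * adic_const y :> cauchy_ring.
  by apply: val_inj; rewrite rmorphM.
by rewrite rmorphM.
Qed.

HB.instance Definition _ :=
  GRing.isZmodMorphism.Build K adic_completion adic_embed adic_embed_zmod.
HB.instance Definition _ :=
  GRing.isMonoidMorphism.Build K adic_completion adic_embed adic_embed_monoid.

(* The valuation ring of the completion: since v_nu is locally constant away from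
   0, its elements are the limits of sequences of nonnegative valuation. *)
Definition adic_integer (x : adic_completion) :=
  exists2 s : cauchy_ring, x = \pi_adic_completion s & forall i, adic_ge 0 (\val s i).

End AdicCompletion.

Section LaurentTopology.
Variable F : fieldType.

(* The T-adic topology: the T^n F[[T]] are a neighborhood basis of 0. *)
Definition laurent_open (U : set (laurent F)) := forall x, U x ->
  exists n, forall f : pseries F, U (x + (psX F ^+ n * f)%:F).

Fact laurent_openT : laurent_open setT.
Proof. by move=> x _; exists 0%N. Qed.

Fact laurent_openI : setI_closed laurent_open.
Proof.
move=> U V Uo Vo x [/Uo[n Un] /Vo[m Vm]]; exists (n + m)%N => f.
split; first by rewrite exprD -mulrA; exact: Un.
by rewrite addnC exprD -mulrA; exact: Vm.
Qed.

Fact laurent_open_bigcup (I : Type) (U : I -> set (laurent F)) :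
  (forall i, laurent_open (U i)) -> laurent_open (\bigcup_i U i).
Proof. by move=> Uo x [i _ /Uo[n Un]]; exists n => f; exists i; last exact: Un. Qed.

HB.instance Definition _ := isOpenTopological.Build (laurent F)
  laurent_openT laurent_openI laurent_open_bigcup.

(* The embedding of F[Y] into F((Y^-1)): evaluation at Y = T^-1. *)
Definition polyinf (p : {poly F}) : laurent F :=
  (map_poly (fun c => (psC c)%:F) p).[(psX F)%:F^-1].

Fact polyinf_zmod : zmod_morphism polyinf.
Proof.
move=> p r; rewrite /polyinf.
by rewrite (rmorphB (map_poly (@FracField.tofrac _ \o @psC F))) hornerD hornerN.
Qed.

Fact polyinf_monoid : monoid_morphism polyinf.
Proof.
split=> [|p r]; rewrite /polyinf.
  by rewrite (rmorph1 (map_poly (@FracField.tofrac _ \o @psC F))) hornerC.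
by rewrite (rmorphM (map_poly (@FracField.tofrac _ \o @psC F))) hornerM.
Qed.

HB.instance Definition _ :=
  GRing.isZmodMorphism.Build {poly F} (laurent F) polyinf polyinf_zmod.
HB.instance Definition _ :=
  GRing.isMonoidMorphism.Build {poly F} (laurent F) polyinf polyinf_monoid.

End LaurentTopology.

Section SpaceOfLattices.
Variable F : finFieldType.
Local Notation Kinf := (laurent F).

Definition GL2 := set_type [set g : 'M[Kinf]_2 | g \in unitmx].
HB.instance Definition _ := Topological.on GL2.

Definition mkGL2 (g : 'M[Kinf]_2) (gu : g \in unitmx) : GL2 :=
  exist (fun h => h \in [set h : 'M[Kinf]_2 | h \in unitmx]) g (mem_set gu).

HB.instance Definition _ := isPointed.Build GL2 (mkGL2 (unitmx1 _ _)).

Lemma GL2_unit (g : GL2) : \val g \in unitmx.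
Proof. by have := valP g; rewrite inE. Qed.

Definition mulGL2 (g h : GL2) : GL2 := mkGL2 (etrans (unitmx_mul _ _)
  (introT andP (conj (GL2_unit g) (GL2_unit h)))).

(* g and h define the same element of PGL_2(K_oo) / PGL_2(R_oo), i.e. the lattices
   g(R_oo^2) and h(R_oo^2) are homothetic: h = a g k, with a in K_oo^* and k in
   GL_2(R_oo). *)
Definition homothetic (g h : GL2) := `[< exists (a : Kinf) (k : 'M[{poly F}]_2),
  [/\ a != 0, k \in unitmx & \val h = a *: (\val g *m map_mx (@polyinf F) k)] >].

Fact homothetic_refl : reflexive homothetic.
Proof.
move=> g; apply/asboolP; exists 1, 1%:M.
by rewrite oner_neq0 unitmx1 map_mx1 mulmx1 scale1r.
Qed.

Lemma homothetic_impl g h : homothetic g h -> homothetic h g.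
Proof.
move=> /asboolP[a [k [a0 ku hE]]]; apply/asboolP; exists a^-1, (invmx k).
split; [by rewrite invr_eq0 | by rewrite unitmx_inv | ].
rewrite hE -scalemxAl scalerA (mulVf a0) scale1r -mulmxA -map_mxM (mulmxV ku).
by rewrite map_mx1 mulmx1.
Qed.

Fact homothetic_sym : symmetric homothetic.
Proof. by move=> g h; apply/idP/idP; exact: homothetic_impl. Qed.

Fact homothetic_trans : transitive homothetic.
Proof.
move=> h g l /asboolP[a [k [a0 ku hE]]] /asboolP[b [m [b0 mu lE]]].
apply/asboolP; exists (b * a), (k *m m).
split; [exact: mulf_neq0 b0 a0 | by rewrite unitmx_mul ku mu | ].
by rewrite lE hE -scalemxAl scalerA map_mxM mulmxA.
Qed.

Canonical homothetic_equiv :=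
  EquivRel homothetic homothetic_refl homothetic_sym homothetic_trans.

(* PGL_2(K_oo) / PGL_2(R_oo), as the quotient of GL_2(K_oo) by K_oo^* GL_2(R_oo). *)
Definition Xinf := quotient_topology {eq_quot homothetic}.
HB.instance Definition _ := PointedTopological.on Xinf.
HB.instance Definition _ := Quotient.on Xinf.

Definition cls (g : GL2) : Xinf := \pi_Xinf g.

(* Left multiplication; see translate_cls for the independence of the representative. *)
Definition translate (a : GL2) (x : Xinf) : Xinf := cls (mulGL2 a (repr x)).

Lemma clsP g h : cls g = cls h <-> exists (a : Kinf) (k : 'M[{poly F}]_2),
  [/\ a != 0, k \in unitmx & \val h = a *: (\val g *m map_mx (@polyinf F) k)].
Proof.
have e := @eqquotP _ _ {eq_quot homothetic} g h.
by split=> [/e/asboolP|gh]; last by apply/e/asboolP.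
Qed.

Lemma translate_cls a g : translate a (cls g) = cls (mulGL2 a g).
Proof.
apply/clsP; have /clsP[b [k [b0 ku E]]] := reprK (cls g).
exists b, k; split; [exact: b0 | exact: ku | ].
by rewrite /= E -scalemxAr mulmxA.
Qed.

End SpaceOfLattices.

Section Orbits.
Variable F : finFieldType.
Local Notation X := (Xinf F).

Definition diagonalGL2 (a : GL2 F) := is_diag_mx (\val a).

Definition A_orbit (x : X) : set X := [set translate a x | a in diagonalGL2].

Definition A_periodic (x : X) := compact (A_orbit x).

Definition borelX := g_sigma_algebraType (@open X).

(* mu is the invariant probability measure on the diagonal orbit of x *)
Definition A_orbit_measure (R : realType) (x : X) (mu : probability borelX R) :=
  mu (A_orbit x) = 1%E /\
  forall a : GL2 F, diagonalGL2 a ->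
    forall B : set borelX, measurable B -> mu (translate a @^-1` B) = mu B.

End Orbits.

Section HeckeTree.
Variables (F : finFieldType) (nu : {poly F}).
Local Notation X := (Xinf F).
Local Notation Kinf := (laurent F).

Definition lattice_of (g : GL2 F) (L : set 'cV[{poly F}]_2) : set 'cV[Kinf]_2 :=
  [set \val g *m map_mx (@polyinf F) v | v in L].

Definition represents (x : X) (L : set 'cV[Kinf]_2) :=
  exists2 g : GL2 F, x = cls g & L = lattice_of g setT.

(* An isomorphism of F[Y]-modules L / L' -> F[Y] / (nu), given by a map [phi] on
   representatives: linear and onto modulo nu, with kernel L' in L. *)
Definition cyclic_quotient (L L' : set 'cV[Kinf]_2) :=
  exists phi : 'cV[Kinf]_2 -> {poly F}, [/\
    forall p u v, L u -> L v ->
      nu %| phi (polyinf p *: u + v) - (p * phi u + phi v),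
    forall p, exists2 u, L u & nu %| phi u - p &
    forall u, L u -> (nu %| phi u <-> L' u)].

Definition hecke_sub (x y : X) := exists L L',
  [/\ represents x L, represents y L', L' `<=` L & cyclic_quotient L L'].

Definition hecke_adj (x y : X) := hecke_sub x y \/ hecke_sub y x.

Fixpoint walk (n : nat) (x y : X) : Prop :=
  if n is m.+1 then exists2 z, hecke_adj x z & walk m z y else x = y.

Definition hecke_tree (x0 : X) : set X := [set y | exists n, walk n x0 y].

Definition geodesic_ray (r : nat -> X) := forall i j, (i <= j)%N ->
  walk (j - i) (r i) (r j) /\ forall m, walk m (r i) (r j) -> (j - i <= m)%N.

Definition cofinal (r s : nat -> X) :=
  exists k l, forall n, r (n + k)%N = s (n + l)%N.

(* Ends are classes of geodesic rays, two rays being equivalent when they coincide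
   eventually, up to a shift. [end_of r] is the class of r. *)
Definition end_of (r : nat -> X) : set (nat -> X) :=
  [set s | geodesic_ray s /\ cofinal r s].

Definition Omega (x0 : X) : set (set (nat -> X)) :=
  [set xi | exists r, [/\ geodesic_ray r, forall n, hecke_tree x0 (r n) &
    xi = end_of r]].

Context (nu_irr : irreducible_poly nu).
Local Notation Knu := (adic_completion nu_irr).

Definition polynu (p : {poly F}) : Knu := adic_embed nu_irr p%:F.

(* L_n = R^2 /\ (O_nu u + nu^n O_nu^2), for u = (a, b) in O_nu^2 *)
Definition line_lattice (u : 'cV[Knu]_2) (n : nat) : set 'cV[{poly F}]_2 :=
  [set v | exists (a : Knu) (w : 'cV[Knu]_2),
    [/\ adic_integer a, forall i, adic_integer (w i 0) &
        map_mx polynu v = a *: u + polynu nu ^+ n *: w]].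

(* a, b in O_nu, not both in nu O_nu *)
Definition primitive_vec (u : 'cV[Knu]_2) :=
  (forall i, adic_integer (u i 0)) /\
  ~ (forall i, exists2 b, adic_integer b & u i 0 = polynu nu * b).

Definition end_at (g : GL2 F) (u : 'cV[Knu]_2) (xi : set (nat -> X)) :=
  exists2 r : nat -> X,
    forall n, represents (r n) (lattice_of g (line_lattice u n)) &
    xi = end_of r.

(* the point [a : b] of P^1(K_nu) comes from P^1(K) *)
Definition K_rational (u : 'cV[Knu]_2) :=
  exists (c : Knu) (w : 'cV[{fraction {poly F}}]_2),
    c != 0 /\ u = c *: map_mx (adic_embed nu_irr) w.

Definition rational_end (x0 : X) (xi : set (nat -> X)) :=
  exists (g : GL2 F) (u : 'cV[Knu]_2),
    [/\ x0 = cls g, primitive_vec u, K_rational u & end_at g u xi].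

End HeckeTree.

Section Escape.
Variables (R : realType) (F : finFieldType).
Local Notation X := (Xinf F).

Definition Cc := {f : X -> R |
  continuous f /\ compact (closure [set x | f x != 0])}.

Definition radon (theta : {measure set (borelX F) -> \bar R}) :=
  forall C : set X, compact C -> (theta C < +oo)%E.

(* The weak-star topology on Radon measures is the topology of pointwise
   convergence of the associated functionals on C_c(X). *)
Definition pairing (theta : {measure set (borelX F) -> \bar R}) : {ptws Cc -> R} :=
  fun f => Rintegral theta setT (sval f : borelX F -> R).

Definition weak_star_accumulation (mu : nat -> probability (borelX F) R)
    (theta : {measure set (borelX F) -> \bar R}) :=
  cluster ((fun n => pairing (mu n)) @ \oo) (pairing theta).

(* x is the geodesic ray from x0 to xi, and mu n the measure attached to x n. *)
Definition Theta (x0 : X) (xi : set (nat -> X)) :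
    set {measure set (borelX F) -> \bar R} :=
  [set theta | radon theta /\
    exists (x : nat -> X) (mu : nat -> probability (borelX F) R),
      [/\ xi x, x 0%N = x0, forall n, A_orbit_measure (x n) (mu n) &
          weak_star_accumulation mu theta]].

Definition uniform_escape (c : R) (x0 : X) (xi : set (nat -> X)) :=
  forall theta, Theta x0 xi theta -> (theta setT <= (1 - c)%:E)%E.

End Escape.

(* Main.v *)
Require Import Defs.
From HB Require Import structures.
From mathcomp Require Import all_boot all_order all_algebra.
From mathcomp Require Import all_classical all_reals all_analysis.
From mathcomp Require Import ring_quotient finfield.
From mathcomp Require Import ring zify.
Import Defs.

(** Write T = 1/Y for the uniformizer of F((1/Y)) and v for its valuation. After a
    change of basis of F[Y]^2, a rational end is the end of the ray of the lattices
    [x_n = g diag(1, nu^n) F[Y]^2] for a matrix g with [x_0 = g F[Y]^2] up to homothety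
    (rational_ray). Such a lattice contains the vector [g e_1], whose size does not
    depend on n, while its covolume grows like [q^(n deg nu)]. Hence x_n is high in the
    cusp, and the diagonal flow needs a time n - O(1) to bring it back to a given
    compact set (ray_cusp).

    On the other hand the orbit of x_n is short. Up to scalars, a diagonal element that
    stabilizes x_0 acts on a basis of x_0 by a matrix gamma in GL_2(F[Y]). A power
    [gamma^e] is 1 modulo nu, and in characteristic l the Frobenius gives
    [gamma^(e l^k) = 1] modulo [nu^(l^k)], which makes the corresponding power of the
    diagonal element stabilize x_n as soon as [n <= l^k]. So the period of x_n is at
    most E n (ray_period), and E depends on x_0 only: changing the basis conjugates
    gamma, which changes neither e nor l. The invariant measure gives the same mass to
    every unit of time of the orbit, so a proportion bounded below by 1/(2E) of it lies
    outside any given compact set once n is large (escape_mass, ray_exhaust_mass).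

    To pass to weak-star limits, the space is exhausted by finite unions of orbits of
    GL_2(F[[T]]). These are compact and open, so their indicator functions are
    continuous with compact support (escape_of_exhaustion).

    The existence of a period of x_0 is read off an invariant probability measure on
    its orbit: the orbit is a countable union of slices of equal mass, which cannot be
    pairwise disjoint (period_exists). If x_0 has no period, its orbit carries no
    invariant probability measure, and every end has uniform escape of mass
    vacuously. *)

Set Implicit Arguments.
Unset Strict Implicit.
Unset Printing Implicit Defensive.
Import Order.TTheory GRing.Theory Num.Theory.
Import numFieldNormedType.Exports.
Local Open Scope classical_set_scope.
Local Open Scope ring_scope.
Local Open Scope quotient_scope.

Local Notation "x %:F" := (@FracField.tofrac _ x).

(** * Power series and Laurent series *)

Lemma fraction_numdenE (D : idomainType) (x : {fraction D}) :
  exists a b : D, b != 0 /\ x = a%:F / b%:F.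
Proof.
elim/quotW: x => r; exists (frac r).1, (frac r).2.
have dr := denom_ratioP r; split=> //.
have dF : ((frac r).2)%:F != 0 :> {fraction D} by rewrite tofrac_eq0.
apply: (canRL (mulfK dF)); rewrite /GRing.mul /=; unlock FracField.tofrac.
rewrite -FracField.pi_mul; apply/eqmodP.
rewrite /= FracField.equivfE /FracField.mulf.
by rewrite !numden_Ratio ?mulf_neq0 ?oner_neq0 // !mulr1 mulrC.
Qed.

Section PowerSeriesUnits.
Variable F : fieldType.
Implicit Types f g z : pseries F.

Lemma pcoefD f g n : pcoef (f + g) n = pcoef f n + pcoef g n.
Proof. by []. Qed.

Lemma pcoefN f n : pcoef (- f) n = - pcoef f n.
Proof. by []. Qed.

Lemma pcoefB f g n : pcoef (f - g) n = pcoef f n - pcoef g n.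
Proof. by []. Qed.

Lemma pcoefM f g n :
  pcoef (f * g) n = \sum_(i < n.+1) pcoef f i * pcoef g (n - i).
Proof. by []. Qed.

Lemma pcoef_sum (I : Type) (r : seq I) (P : pred I) (f : I -> pseries F) n :
  pcoef (\sum_(i <- r | P i) f i) n = \sum_(i <- r | P i) pcoef (f i) n.
Proof.
by rewrite (big_morph (fun g => pcoef g n) (fun g h => pcoefD g h n) (erefl _)).
Qed.

Definition const_coef f : F := pcoef f 0.

Fact const_coef_zmod : zmod_morphism const_coef. Proof. by []. Qed.
Fact const_coef_monoid : monoid_morphism const_coef.
Proof. by split=> [|f g]; rewrite /const_coef //= big_ord1. Qed.
HB.instance Definition _ :=
  GRing.isZmodMorphism.Build (pseries F) F const_coef const_coef_zmod.
HB.instance Definition _ :=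
  GRing.isMonoidMorphism.Build (pseries F) F const_coef const_coef_monoid.

Lemma pcoef_psXM f n : pcoef (psX F * f) n = if n is m.+1 then pcoef f m else 0.
Proof.
case: n => [|n]; first by rewrite pcoefM big_ord1 /= mul0r.
rewrite pcoefM big_ord_recl /= mul0r add0r big_ord_recl /= mul1r.
by rewrite subSS subn0 big1 ?addr0 // => i _; rewrite mul0r.
Qed.

Lemma pcoef_psXnM f m n :
  pcoef (psX F ^+ m * f) n = if (n < m)%N then 0 else pcoef f (n - m).
Proof.
elim: m f n => [|m IH] f n; first by rewrite mul1r subn0.
by rewrite exprS -mulrA pcoef_psXM; case: n => [//|n]; rewrite IH ltnS subSS.
Qed.

Lemma ps_shift f n : (forall i, (i < n)%N -> pcoef f i = 0) ->
  f = psX F ^+ n * PSeries (fun i => pcoef f (n + i)).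
Proof.
move=> fn; apply: pseriesP => i; rewrite pcoef_psXnM.
by case: ltnP => [/fn //|ni] /=; rewrite subnKC.
Qed.

Lemma ps_factor f : f != 0 ->
  exists n g, pcoef g 0 != 0 /\ f = psX F ^+ n * g.
Proof.
move=> /ps_ord[n [fn fi]]; exists n, (PSeries (fun i => pcoef f (n + i))).
by split; [rewrite /= addn0 | exact: ps_shift].
Qed.

(** With constant term 1, the inverse of 1 - z is the geometric series; its n-th
    coefficient is read off the partial sum up to z^n. *)
Lemma ps_unit_geometric z : pcoef z 0 = 0 -> 1 - z \is a GRing.unit.
Proof.
move=> z0; have zX : z = psX F * PSeries (fun i => pcoef z i.+1).
  rewrite -[psX F]expr1; apply: ps_shift => i.
  by rewrite ltnS leqn0 => /eqP ->.
have zn i n : (n < i)%N -> pcoef (z ^+ i) n = 0.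
  by move=> ni; rewrite zX exprMn pcoef_psXnM ni.
pose S N := \sum_(i < N) z ^+ i.
have Sext n N : (n < N)%N -> pcoef (S N) n = pcoef (S n.+1) n.
  elim: N => // N IH; rewrite ltnS leq_eqVlt => /predU1P[-> //|nN].
  by rewrite /S big_ord_recr pcoefD /= zn // addr0 IH.
suff E : PSeries (fun n => pcoef (S n.+1) n) * (1 - z) = 1.
  by apply/asboolP; exists (PSeries (fun n => pcoef (S n.+1) n)).
rewrite mulrC; apply: pseriesP => n.
transitivity (pcoef ((1 - z) * S n.+1) n).
  rewrite !pcoefM; apply: eq_bigr => i _ /=.
  by rewrite (Sext (n - i)%N n.+1) // ltnS leq_subr.
rewrite /S -[1 - z]opprB mulNr -subrX1 opprB pcoefD pcoefN.
by rewrite (zn _ _ (ltnSn n)) subr0.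
Qed.

Lemma ps_unitE f : (f \is a GRing.unit) = (pcoef f 0 != 0).
Proof.
apply/idP/idP => [uf|f0].
  have : const_coef f \is a GRing.unit by apply: rmorph_unit.
  by rewrite unitfE.
have uc : psC (pcoef f 0) \is a GRing.unit by apply: rmorph_unit; rewrite unitfE.
suff : (psC (pcoef f 0))^-1 * f \is a GRing.unit by rewrite unitrM => /andP[].
have -> : (psC (pcoef f 0))^-1 * f = 1 - (1 - (psC (pcoef f 0))^-1 * f).
  by rewrite opprB addrCA subrr addr0.
apply: ps_unit_geometric.
rewrite -[LHS]/(const_coef _) rmorphB rmorphM rmorph1 rmorphV //=.
by rewrite /const_coef /= mulr1n mulVf ?subrr.
Qed.

End PowerSeriesUnits.

Section Valuation.
Variable F : fieldType.
Local Notation Kinf := (laurent F).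
Implicit Types (x y : Kinf) (f g : pseries F) (n m : int).

Definition uniformizer : Kinf := (psX F)%:F.
Local Notation T := uniformizer.

Lemma uniformizer_neq0 : T != 0.
Proof.
rewrite tofrac_eq0; apply/eqP => /(congr1 (fun f => pcoef f 1)) /eqP.
by rewrite /= oner_eq0.
Qed.

Lemma laurent_form x : x != 0 ->
  exists n f, f \is a GRing.unit /\ x = T ^ n * f%:F.
Proof.
have [f [g [g0 ->]]] := fraction_numdenE x.
rewrite mulf_eq0 negb_or tofrac_eq0 => /andP[f0 _].
have [i [f1 [uf1 ->]]] := ps_factor f0; have [j [g1 [ug1 ->]]] := ps_factor g0.
rewrite -!ps_unitE in uf1 ug1.
have g1F : g1%:F != 0 :> Kinf.
  by rewrite tofrac_eq0; apply: contraTneq ug1 => ->; rewrite unitr0.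
exists (i%:Z - j%:Z), (f1 / g1); split; first by rewrite unitrM uf1 unitrV.
rewrite expfzDr ?uniformizer_neq0 // -invr_expz !tofracM !tofracXn !exprnP.
have -> : (g1^-1)%:F = (g1%:F)^-1 :> Kinf.
  by apply: (mulfI g1F); rewrite -tofracM divrr // tofrac1 divff.
by rewrite invfM mulrACA.
Qed.

Lemma laurent_form_le n m f g : f \is a GRing.unit ->
  T ^ n * f%:F = T ^ m * g%:F -> m <= n.
Proof.
move=> uf E; rewrite leNgt; apply/negP => nm.
move: uf; rewrite ps_unitE; suff -> : f = psX F ^+ `|m - n|%N * g.
  by rewrite pcoef_psXnM absz_gt0 subr_eq0 gt_eqF // eqxx.
apply/eqP; rewrite -(@tofrac_eq (pseries F)); apply/eqP.
apply: (mulfI (expfz_neq0 n uniformizer_neq0)); rewrite E.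
rewrite tofracM tofracXn exprnP mulrA -expfzDr ?uniformizer_neq0 //.
by rewrite gez0_abs ?subr_ge0 1?ltW // subrKC.
Qed.

(** The valuation of F((T)), normalized by v(T) = 1; its value at 0 is a dummy 0. *)
Definition vval x : int :=
  xget 0 [set n | exists2 f, f \is a GRing.unit & x = T ^ n * f%:F].

Lemma vvalE n f : f \is a GRing.unit -> vval (T ^ n * f%:F) = n.
Proof.
move=> uf; rewrite /vval; case: xgetP => [m _ [g ug /[dup] E /esym E']|none].
  by apply: le_anti; rewrite (laurent_form_le uf E) (laurent_form_le ug E').
by case: (none n); exists f.
Qed.

Lemma vvalM x y : x != 0 -> y != 0 -> vval (x * y) = vval x + vval y.
Proof.
move=> /laurent_form[n [f [uf ->]]] /laurent_form[m [g [ug ->]]].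
rewrite mulrACA -expfzDr ?uniformizer_neq0 // -tofracM !vvalE //.
by rewrite unitrM uf.
Qed.

Lemma vval_unit f : f \is a GRing.unit -> vval f%:F = 0.
Proof. by move=> uf; have := vvalE 0 uf; rewrite expr0z mul1r. Qed.

Lemma vval1 : vval 1 = 0.
Proof. by rewrite -tofrac1 vval_unit // unitr1. Qed.

Lemma vvalT n : vval (T ^ n) = n.
Proof. by rewrite -[T ^ n]mulr1 -tofrac1 vvalE // unitr1. Qed.

Lemma vvalV x : x != 0 -> vval x^-1 = - vval x.
Proof.
move=> x0; apply: (addIr (vval x)); rewrite addNr -vvalM ?invr_eq0 //.
by rewrite (mulVf x0) vval1.
Qed.

Lemma vvalX x (k : nat) : x != 0 -> vval (x ^+ k) = vval x *+ k.
Proof.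
move=> x0; elim: k => [|k IH]; first by rewrite expr0 vval1.
by rewrite exprS vvalM ?expf_neq0 // IH mulrS.
Qed.

(** The fractional ideal T^n F[[T]]. *)
Definition laurent_ge n x := exists f, x = T ^ n * f%:F.

Lemma laurent_geP n x : x != 0 -> laurent_ge n x <-> n <= vval x.
Proof.
move=> /laurent_form[m [f [uf ->]]]; rewrite vvalE //; split=> [[g]|nm].
  exact: laurent_form_le.
exists (psX F ^+ `|m - n|%N * f); rewrite tofracM tofracXn exprnP mulrA.
by rewrite -expfzDr ?uniformizer_neq0 // gez0_abs ?subr_ge0 // subrKC.
Qed.

Lemma laurent_ge_vval x : laurent_ge (vval x) x.
Proof.
have [->|x0] := eqVneq x 0; first by exists 0; rewrite tofrac0 mulr0.
exact/laurent_geP.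
Qed.

Lemma laurent_ge0 n : laurent_ge n 0.
Proof. by exists 0; rewrite tofrac0 mulr0. Qed.

Lemma laurent_geD n x y : laurent_ge n x -> laurent_ge n y -> laurent_ge n (x + y).
Proof. by move=> [f ->] [g ->]; exists (f + g); rewrite tofracD mulrDr. Qed.

Lemma laurent_geN n x : laurent_ge n x -> laurent_ge n (- x).
Proof. by move=> [f ->]; exists (- f); rewrite tofracN mulrN. Qed.

Lemma laurent_geM n m x y :
  laurent_ge n x -> laurent_ge m y -> laurent_ge (n + m) (x * y).
Proof.
move=> [f ->] [g ->]; exists (f * g).
by rewrite expfzDr ?uniformizer_neq0 // tofracM mulrACA.
Qed.

Lemma laurent_ge_le n m x : m <= n -> laurent_ge n x -> laurent_ge m x.
Proof.
have [->|x0] := eqVneq x 0; first by move=> _ _; exact: laurent_ge0.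
by move=> mn /laurent_geP nx; apply/laurent_geP => //; rewrite (le_trans mn) ?nx.
Qed.

Lemma laurent_ge_ps f : laurent_ge 0 f%:F.
Proof. by exists f; rewrite expr0z mul1r. Qed.

Lemma laurent_ge_sum n (I : Type) (r : seq I) (E : I -> Kinf) :
  (forall i, laurent_ge n (E i)) -> laurent_ge n (\sum_(i <- r) E i).
Proof. by move=> En; elim/big_ind: _ => //; [exact: laurent_ge0 | exact: laurent_geD]. Qed.

Lemma laurent_ge_eq0 x : (forall n, laurent_ge n x) -> x = 0.
Proof.
move=> xn; apply/eqP; apply: contraT => x0.
by have /laurent_geP := xn (vval x + 1); rewrite gerDl ler10 => /(_ x0).
Qed.

Lemma polyinfC (c : F) : polyinf c%:P = (psC c)%:F.
Proof.
by rewrite /polyinf (map_polyC (@FracField.tofrac _ \o @psC F)) hornerC.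
Qed.

Lemma polyinfX : polyinf ('X : {poly F}) = T^-1.
Proof.
by rewrite /polyinf (map_polyX (@FracField.tofrac _ \o @psC F)) hornerX.
Qed.

Lemma polyinfE (p : {poly F}) :
  polyinf p = \sum_(i < size p) (psC p`_i)%:F * T ^ (- (i%:Z)).
Proof.
rewrite -{1}[p]coefK poly_def rmorph_sum; apply: eq_bigr => i _.
rewrite -mul_polyC rmorphM rmorphXn /= polyinfC polyinfX; congr (_ * _).
by rewrite exprVn -exprnN.
Qed.

Lemma polyinf_form (p : {poly F}) : p != 0 ->
  exists2 f, f \is a GRing.unit & polyinf p = T ^ (- (size p).-1%:Z) * f%:F.
Proof.
move=> p0; set d := (size p).-1.
have dE : size p = d.+1 by rewrite prednK // size_poly_gt0.
exists (\sum_(i < d.+1) psC p`_i * psX F ^+ (d - i)).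
  rewrite ps_unitE pcoef_sum big_ord_recr big1 => [|i _].
    rewrite subnn expr0 mulr1 -[X in X != 0]/(0 + lead_coef p).
    by rewrite add0r lead_coef_eq0.
  by rewrite mulrC pcoef_psXnM subn_gt0 [(_ < d)%N](ltn_ord i).
rewrite polyinfE dE rmorph_sum mulr_sumr; apply: eq_bigr => i _.
rewrite rmorphM rmorphXn /= mulrCA; congr (_ * _).
rewrite exprnP -expfzDr ?uniformizer_neq0 //; congr (_ ^ _).
by rewrite -subzn ?addKr // -ltnS.
Qed.

Lemma polyinf_eq0 (p : {poly F}) : (polyinf p == 0) = (p == 0).
Proof.
have [->|p0] := eqVneq p 0; first by rewrite rmorph0 eqxx.
have [f uf ->] := polyinf_form p0; apply/negbTE; rewrite mulf_neq0 //.
  exact: expfz_neq0 uniformizer_neq0.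
by rewrite tofrac_eq0; apply: contraTneq uf => ->; rewrite unitr0.
Qed.

Lemma polyinf_inj : injective (@polyinf F).
Proof.
by move=> p r /eqP; rewrite -subr_eq0 -rmorphB polyinf_eq0 subr_eq0 => /eqP.
Qed.

Lemma vval_polyinf (p : {poly F}) : p != 0 -> vval (polyinf p) = - ((size p).-1%:Z).
Proof. by move=> /polyinf_form[f uf ->]; exact: vvalE. Qed.

Lemma polyinf_ge_size (p : {poly F}) (k : nat) :
  laurent_ge (- k%:Z) (polyinf p) -> (size p <= k.+1)%N.
Proof.
have [->|p0] := eqVneq p 0; first by rewrite size_poly0.
move/laurent_geP; rewrite polyinf_eq0 vval_polyinf // => /(_ p0).
by rewrite lerN2 lez_nat; case: (size p).
Qed.

(** Discreteness of F[Y] in F((1/Y)): a nonzero polynomial in Y has nonpositive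
    valuation. *)
Lemma polyinf_ge1 (p : {poly F}) : laurent_ge 1 (polyinf p) -> p = 0.
Proof.
move=> p1; apply/eqP; apply: contraT => p0.
by move/laurent_geP: p1; rewrite polyinf_eq0 vval_polyinf // => /(_ p0); lia.
Qed.

End Valuation.

(** * Matrices over the local field, and the topology of the space of lattices *)

Section MatrixValuation.
Variable F : fieldType.
Local Notation Kinf := (laurent F).
Local Notation T := (uniformizer F).
Implicit Types n m : int.

Definition mx_ge n p q (A : 'M[Kinf]_(p, q)) := forall i j, laurent_ge n (A i j).

Lemma mx_ge_ex p q (A : 'M[Kinf]_(p, q)) : exists n, mx_ge n A.
Proof.
exists (\big[Order.min/0]_(ij : 'I_p * 'I_q) vval (A ij.1 ij.2)) => i j.
by apply: laurent_ge_le (laurent_ge_vval _); exact: (bigmin_le_cond _ _ (j := (i, j))).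
Qed.

Lemma mx_ge_le n m p q (A : 'M[Kinf]_(p, q)) : m <= n -> mx_ge n A -> mx_ge m A.
Proof. by move=> mn An i j; exact: laurent_ge_le mn (An i j). Qed.

Lemma mx_geD n p q (A B : 'M[Kinf]_(p, q)) :
  mx_ge n A -> mx_ge n B -> mx_ge n (A + B).
Proof. by move=> An Bn i j; rewrite mxE; exact: laurent_geD. Qed.

Lemma mx_geN n p q (A : 'M[Kinf]_(p, q)) : mx_ge n A -> mx_ge n (- A).
Proof. by move=> An i j; rewrite mxE; exact: laurent_geN. Qed.

Lemma mx_geM n m p q r (A : 'M[Kinf]_(p, q)) (B : 'M[Kinf]_(q, r)) :
  mx_ge n A -> mx_ge m B -> mx_ge (n + m) (A *m B).
Proof.
by move=> An Bm i j; rewrite mxE; apply: laurent_ge_sum => k; exact: laurent_geM.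
Qed.

Lemma mx_geZ n m p q (c : Kinf) (A : 'M[Kinf]_(p, q)) :
  laurent_ge n c -> mx_ge m A -> mx_ge (n + m) (c *: A).
Proof. by move=> cn Am i j; rewrite mxE; exact: laurent_geM. Qed.

Definition ps_mx p q (f : 'M[pseries F]_(p, q)) : 'M[Kinf]_(p, q) :=
  map_mx (@FracField.tofrac (pseries F)) f.

Lemma mx_ge_ps p q (f : 'M[pseries F]_(p, q)) : mx_ge 0 (ps_mx f).
Proof. by move=> i j; rewrite mxE; exact: laurent_ge_ps. Qed.

Lemma mx_geE n p q (A : 'M[Kinf]_(p, q)) :
  mx_ge n A <-> exists f, A = T ^ n *: ps_mx f.
Proof.
split=> [An|[f ->]]; last first.
  by rewrite -[X in mx_ge X _]addr0; apply: mx_geZ (mx_ge_ps f); exists 1; rewrite tofrac1 mulr1.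
have [f fE] := choice (fun ij : 'I_p * 'I_q => An ij.1 ij.2).
by exists (\matrix_(i, j) f (i, j)); apply/matrixP => i j; rewrite !mxE (fE (i, j)).
Qed.

Lemma ps_mxM (f g : 'M[pseries F]_2) : ps_mx (f *m g) = ps_mx f *m ps_mx g.
Proof. exact: map_mxM. Qed.

Lemma det_ps_mx (f : 'M[pseries F]_2) : \det (ps_mx f) = (\det f)%:F.
Proof. exact: det_map_mx. Qed.

Lemma ps_unitmxE (f : 'M[pseries F]_2) :
  (f \in unitmx) = (map_mx (@const_coef F) f \in unitmx).
Proof. by rewrite !unitmxE det_map_mx ps_unitE unitfE. Qed.

Lemma ps_mx_unit (f : 'M[pseries F]_2) : f \in unitmx -> ps_mx f \in unitmx.
Proof.
rewrite !unitmxE det_ps_mx unitfE tofrac_eq0 => uf.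
by apply: contraTneq uf => ->; rewrite unitr0.
Qed.

End MatrixValuation.

(** Locked copies of the product and the inverse: unification compares them as symbols
    of a group instead of entry by entry in a field of fractions. *)
HB.lock Definition GL2mul (F : finFieldType) (g h : GL2 F) : GL2 F := mulGL2 g h.

HB.lock Definition GL2inv (F : finFieldType) (g : GL2 F) : GL2 F :=
  mkGL2 (etrans (unitmx_inv (\val g)) (GL2_unit g)).

Section GroupGL2.
Variable F : finFieldType.
Local Notation Kinf := (laurent F).
Local Notation T := (uniformizer F).
Implicit Types (g h k : GL2 F).

Lemma val_GL2mul g h : \val (GL2mul g h) = \val g *m \val h.
Proof. by rewrite GL2mul.unlock. Qed.

Lemma val_GL2inv g : \val (GL2inv g) = invmx (\val g).
Proof. by rewrite GL2inv.unlock. Qed.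

Lemma GL2mulA g h k : GL2mul g (GL2mul h k) = GL2mul (GL2mul g h) k.
Proof. by apply: val_inj; rewrite /= !val_GL2mul mulmxA. Qed.

Lemma GL2mulVr g h : GL2mul (GL2mul g (GL2inv h)) h = g.
Proof.
by apply: val_inj; rewrite /= !val_GL2mul val_GL2inv (mulmxKV (GL2_unit h)).
Qed.

Lemma GL2mulVl g h : GL2mul (GL2inv g) (GL2mul g h) = h.
Proof.
by apply: val_inj; rewrite /= !val_GL2mul val_GL2inv (mulKmx (GL2_unit g)).
Qed.

Lemma translate_GL2mul g h : translate g (cls h) = cls (GL2mul g h).
Proof. by rewrite GL2mul.unlock translate_cls. Qed.

Lemma GL2_det_neq0 g : \det (\val g) != 0.
Proof. by have := GL2_unit g; rewrite unitmxE unitfE. Qed.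

(** The maximal compact subgroup GL_2(F[[T]]). *)
Definition integral_unit k :=
  exists2 f : 'M[pseries F]_2, f \in unitmx & \val k = ps_mx f.

Lemma integral_unitM k k' :
  integral_unit k -> integral_unit k' -> integral_unit (GL2mul k k').
Proof.
move=> [f uf kE] [f' uf' kE']; exists (f *m f'); first by rewrite unitmx_mul uf.
by rewrite val_GL2mul kE kE' ps_mxM.
Qed.

Lemma integral_unitV k : integral_unit k -> integral_unit (GL2inv k).
Proof.
move=> [f uf kE]; exists (invmx f); first by rewrite unitmx_inv.
by rewrite val_GL2inv kE; apply: (can_inj (mulmxK (ps_mx_unit uf)));
  rewrite -ps_mxM mulVmx ?ps_mx_unit // mulVmx // /ps_mx map_mx1.
Qed.

Lemma integral_unit_ge k : integral_unit k -> mx_ge 0 (\val k).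
Proof. by move=> [f _ ->]; exact: mx_ge_ps. Qed.

Lemma integral_unit_det k : integral_unit k -> vval (\det (\val k)) = 0.
Proof. by move=> [f uf ->]; rewrite det_ps_mx vval_unit // -unitmxE. Qed.

(** The principal congruence subgroup of level m + 1. The shift makes all of them
    subgroups of GL_2(F[[T]]). *)
Definition near1 (m : nat) k := mx_ge m.+1%:Z (\val k - 1%:M).

Lemma near1_mx (A : 'M[Kinf]_2) : mx_ge 1 (A - 1%:M) ->
  exists2 f : 'M[pseries F]_2, f \in unitmx & A = ps_mx f.
Proof.
move=> /mx_geE[f fE]; exists (1%:M + psX F *: f).
  rewrite ps_unitmxE (_ : map_mx _ _ = 1%:M) ?unitmx1 //.
  apply/matrixP => i j; rewrite !mxE rmorphD rmorphM /=.
  by rewrite {2}/const_coef /= mul0r addr0 rmorph_nat.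
rewrite -[LHS](subrK 1%:M) fE addrC /ps_mx map_mxD map_mxZ map_mx1.
by rewrite expr1z.
Qed.

Lemma near1_integral m k : near1 m k -> integral_unit k.
Proof. by move=> km; apply: near1_mx; apply: mx_ge_le km. Qed.

Lemma near1_le m n k : (m <= n)%N -> near1 n k -> near1 m k.
Proof. by move=> mn; apply: mx_ge_le; rewrite lez_nat. Qed.

End GroupGL2.

Section Topology.
Variable F : finFieldType.
Local Notation Kinf := (laurent F).
Local Notation T := (uniformizer F).
Local Notation X := (Xinf F).
Implicit Types (g h k : GL2 F).

Lemma laurent_ball_open (x : Kinf) (n : int) : open [set y | laurent_ge n (y - x)].
Proof.
rewrite -[open _]/(laurent_open _) => y /= yx; exists `|n|%N => f /=.
rewrite addrAC; apply: laurent_geD => //.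
apply: (@laurent_ge_le _ `|n|%N); first by rewrite abszE ler_norm.
by exists f; rewrite tofracM tofracXn exprnP.
Qed.

(** The topology of GL_2 has a basis made of right cosets of congruence subgroups: the
    additive perturbation h + e is the product (1 + e h^-1) h. Left invariance thus
    gives openness in the quotient space. *)
Lemma GL2_openP (V : set (GL2 F)) : open V <->
  forall h, V h -> exists m, forall k, near1 m k -> V (GL2mul k h).
Proof.
split=> [[U Uo <-] h /= Uh|Vn].
  have [P hP PU] : nbhs (\val h) U by apply: open_nbhs_nbhs.
  have /choice[n nP] : forall ij : 'I_2 * 'I_2, exists n,
      forall y, laurent_ge n (y - \val h ij.1 ij.2) -> P ij.1 ij.2 y.
    move=> [i j]; have := hP i j; rewrite nbhsE => -[W [Wo /Wo[n Wn]] WP].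
    exists n => y /= [f yE]; apply: WP; have := Wn f.
    by rewrite tofracM tofracXn exprnP -yE subrKC.
  have [b hb] := mx_ge_ex (\val h).
  (* S is an upper bound of the exponents n ij. *)
  pose S : int := \sum_ij `|n ij|; exists `|S - b|%N => k k1;
  suff : U (\val k *m \val h) by rewrite -val_GL2mul.
  apply: PU => i j.
  apply: (nP (i, j)) => /=.
  have -> : (\val k *m \val h) i j - \val h i j = ((\val k - 1%:M) *m \val h) i j.
    by rewrite mulmxBl mul1mx !mxE.
  apply: laurent_ge_le (mx_geM k1 hb i j).
  have : n (i, j) <= S.
    rewrite /S (bigD1 (i, j)) //= (le_trans (ler_norm _)) // lerDl.
    exact: sumr_ge0.
  by move: (n _) S {k1} => z S; lia.
have /choice[m mP] : forall h, exists m, V h -> forall k, near1 m k -> V (GL2mul k h).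
  move=> h; have [/Vn[m mP]|nVh] := pselect (V h); first by exists m.
  by exists 0%N.
have /choice[b bP] : forall h, exists b, mx_ge b (\val (GL2inv h)).
  by move=> h; exact: mx_ge_ex.
pose r h := (m h).+1%:Z - b h.
exists [set A | exists2 h, V h & mx_ge (r h) (A - \val h)].
  rewrite openE => A [h Vh Ah]; exists (fun i j => [set y | laurent_ge (r h) (y - \val h i j)]).
    move=> i j; apply: open_nbhs_nbhs; split; first exact: laurent_ball_open.
    by have := Ah i j; rewrite !mxE.
  by move=> B /= Bh; exists h => // i j; rewrite !mxE; exact: Bh.
apply/seteqP; split=> [g [h Vh gh]|g Vg] /=; last first.
  by exists g => // i j; rewrite subrr mxE; exact: laurent_ge0.
rewrite -(GL2mulVr g h); apply: mP => //.
rewrite /near1 (_ : (m h).+1%:Z = r h + b h); last by rewrite subrK.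
suff -> : \val (GL2mul g (GL2inv h)) - 1%:M = (\val g - \val h) *m \val (GL2inv h).
  exact: mx_geM (bP h).
by rewrite val_GL2mul mulmxBl val_GL2inv (mulmxV (GL2_unit h)).
Qed.

Lemma cls_continuous : continuous (@cls F).
Proof. exact: pi_continuous. Qed.

Lemma Xinf_openP (U : set X) : open U <->
  forall h, U (cls h) -> exists m, forall k, near1 m k -> U (cls (GL2mul k h)).
Proof. exact: GL2_openP. Qed.

Definition integral_invariant (U : set X) :=
  forall k h, integral_unit k -> U (cls h) -> U (cls (GL2mul k h)).

Lemma integral_invariantC U : integral_invariant U -> integral_invariant (~` U).
Proof.
move=> Uk k h ik nU /(Uk (GL2inv k) _ (integral_unitV ik)).
by rewrite GL2mulVl.
Qed.

(** The maximal compact subgroup is open, so its orbits, and their unions, are both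
    open and closed. *)
Lemma integral_invariant_open U : integral_invariant U -> open U.
Proof.
by move=> Uk; apply/Xinf_openP => h Uh; exists 0%N => k /near1_integral /Uk; apply.
Qed.

Lemma integral_invariant_closed U : integral_invariant U -> closed U.
Proof.
by move=> /integral_invariantC/integral_invariant_open; rewrite openC.
Qed.

Lemma ultra_finite (S : Type) (U : finType) (f : S -> U) (G : set_system S) :
  UltraFilter G -> exists u, G (f @^-1` [set u]).
Proof.
move=> GU; apply: contrapT => /forallNP nG.
suff : G [set s | f s \notin enum U].
  by move=> /filter_ex[s]; rewrite /= mem_enum.
elim: (enum U) => [|u r IH]; first by apply: filterS filterT.
have [/nG//|Gu] := in_ultra_setVsetC (f @^-1` [set u]) GU.
apply: filterS (filterI Gu IH) => s /= [/eqP fu fr].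
by rewrite inE negb_or fu.
Qed.

(** A coefficientwise limit along an ultrafilter exists because each coefficient
    takes finitely many values. *)
Lemma integral_coset_compact g :
  compact [set h | exists2 k, integral_unit k & h = GL2mul k g].
Proof.
rewrite compact_ultra => G GU GS.
set S := [set h | _] in GS *.
have /choice[kap kapP] : forall h, exists f : 'M[pseries F]_2,
    S h -> f \in unitmx /\ \val h = ps_mx f *m \val g.
  move=> h; have [[k [f uf kE] hE]|nS] := pselect (S h); last by exists 0.
  by exists f => _; split=> //; rewrite hE val_GL2mul kE.
pose c n h : 'M[F]_2 := map_mx (fun f => pcoef f n) (kap h).
have /choice[A GA] : forall n, exists A, G (c n @^-1` [set A]).
  by move=> n; exact: ultra_finite.
have GAn n : G [set h | S h /\ forall i, (i < n)%N -> c i h = A i].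
  elim: n => [|n IH]; first by apply: filterS GS => h; split.
  apply: filterS (filterI IH (GA n)) => h [[Sh hn] /= hA]; split=> // i.
  by rewrite ltnS leq_eqVlt => /predU1P[-> //|]; exact: hn.
pose a : 'M[pseries F]_2 := \matrix_(i, j) PSeries (fun n => A n i j).
have ua : a \in unitmx.
  have [h [Sh h0]] := filter_ex (GAn 1%N).
  rewrite ps_unitmxE (_ : map_mx _ a = map_mx (@const_coef F) (kap h)).
    by rewrite -ps_unitmxE; have [] := kapP _ Sh.
  apply/matrixP => i j; rewrite !mxE /const_coef /= -(h0 0%N) //.
  by rewrite /c mxE.
pose ka : GL2 F := mkGL2 (ps_mx_unit ua).
exists (GL2mul ka g); split; first by exists ka => //; exists a.
move=> V; rewrite nbhsE => -[W [/GL2_openP Wo /Wo[m Wm]] WV].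
apply: filterS (GAn m.+1) => h [Sh hm]; apply: WV.
have ika : integral_unit ka by exists a.
rewrite -(GL2mulVr h (GL2mul ka g)); apply: Wm.
have [uk hE] := kapP _ Sh.
rewrite /near1.
have -> : \val (GL2mul h (GL2inv (GL2mul ka g))) = ps_mx (kap h) *m \val (GL2inv ka).
  apply: (can_inj (mulmxK (GL2_unit (GL2mul ka g)))).
  by rewrite -val_GL2mul GL2mulVr hE -mulmxA -val_GL2mul GL2mulVl.
have -> : 1%:M = ps_mx a *m \val (GL2inv ka) by rewrite val_GL2inv (mulmxV (GL2_unit ka)).
rewrite -mulmxBl -[m.+1%:Z]addr0.
apply: mx_geM (integral_unit_ge (integral_unitV ika)) => i j.
exists (PSeries (fun n => pcoef (kap h i j - a i j) (m.+1 + n))).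
rewrite !mxE -tofracB -exprnP -tofracXn -tofracM; congr tofrac.
apply: ps_shift => n nm; rewrite pcoefB.
by rewrite /= -(hm n nm) /c mxE subrr.
Qed.

(** These orbits of GL_2(F[[T]]) are the compact open pieces of the space: being
    contained in finitely many of them plays the role of being away from the cusp. *)
Definition integral_orbit g : set X :=
  [set cls (GL2mul k g) | k in @integral_unit F].

Lemma integral_orbit_invariant g : integral_invariant (integral_orbit g).
Proof.
move=> k h ik [k' ik' /clsP[a [p [a0 up hE]]]].
exists (GL2mul k k'); first exact: integral_unitM.
apply/clsP; exists a, p; split; [exact: a0 | exact: up |].
rewrite val_GL2mul hE -scalemxAr; congr (_ *: _).
by rewrite mulmxA !val_GL2mul; congr (_ *m _); exact: mulmxA.
Qed.

Lemma integral_orbit_compact g : compact (integral_orbit g).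
Proof.
have := continuous_compact (continuous_subspaceT cls_continuous)
  (integral_coset_compact (g := g)).
congr compact; apply/seteqP; split=> [_ [_ [k ik ->] <-]|_ [k ik <-]].
  by exists k.
by exists (GL2mul k g) => //; exists k.
Qed.

Definition ps_of_poly (p : {poly F}) : pseries F := PSeries (fun n => p`_n).

(** Every lattice class has a representative whose columns are polynomials in T:
    truncate a representative beyond the size of its inverse. *)
Lemma integral_orbit_poly (x : X) : exists2 p : 'M[{poly F}]_2,
  ps_mx (map_mx ps_of_poly p) \in unitmx &
  forall h, \val h = ps_mx (map_mx ps_of_poly p) -> integral_orbit h x.
Proof.
have [g <-] : exists g, cls g = x by exists (repr x); exact: reprK.
have [b gb] := mx_ge_ex (\val g).
have [b' gb'] := mx_ge_ex (\val (GL2inv g)).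
have /mx_geE[f fE] := gb; have Tb0 := expfz_neq0 b (uniformizer_neq0 F).
(* At precision N the truncation multiplied by T^b g^-1 is congruent to 1 modulo T. *)
pose N := absz (1 - (b + b'))%R.
pose h0 := ps_mx (map_mx ps_of_poly (map_mx (ps_trunc N) f)).
have h0f : mx_ge N (h0 - ps_mx f).
  move=> i j; exists (PSeries (fun n => - pcoef (f i j) (N + n))).
  rewrite !mxE -tofracB -exprnP -tofracXn -tofracM; congr tofrac.
  apply: pseriesP => n; rewrite pcoef_psXnM pcoefB /= coef_poly.
  by case: ltnP => nN; rewrite ?subrr // sub0r subnKC.
have [|k uk kE] := near1_mx (A := h0 *m (T ^ b *: \val (GL2inv g))).
  have -> : 1%:M = ps_mx f *m (T ^ b *: \val (GL2inv g)).
    by rewrite -scalemxAr scalemxAl -fE val_GL2inv (mulmxV (GL2_unit g)).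
  have Tb : laurent_ge b (T ^ b) by exists 1; rewrite tofrac1 mulr1.
  by rewrite -mulmxBl; apply: mx_ge_le (mx_geM h0f (mx_geZ Tb gb')); rewrite /N; lia.
have h0E : h0 = T ^ (- b) *: (ps_mx k *m \val g).
  rewrite -kE -scalemxAr -scalemxAl scalerA -expfzDr ?uniformizer_neq0 //.
  by rewrite addNr expr0z scale1r val_GL2inv (mulmxKV (GL2_unit g)).
have kI := integral_unitV (ex_intro2 _ _ k uk (erefl (\val (mkGL2 (ps_mx_unit uk))))).
exists (map_mx (ps_trunc N) f).
  rewrite -/h0 h0E unitmxZ; last by rewrite unitfE expfz_neq0 // uniformizer_neq0.
  by rewrite unitmx_mul ps_mx_unit // GL2_unit.
move=> h; rewrite -/h0 => hE; exists (GL2inv (mkGL2 (ps_mx_unit uk))) => //.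
apply/clsP; exists (T ^ b), 1%:M; split; [exact: Tb0 | exact: unitmx1 |].
rewrite map_mx1 mulmx1 val_GL2mul val_GL2inv hE h0E -scalemxAr scalerA.
rewrite -expfzDr ?uniformizer_neq0 // subrr expr0z scale1r.
by rewrite (mulKmx (ps_mx_unit uk)).
Qed.

End Topology.

(** * Slices of the orbits of the diagonal group *)

Section Slices.
Variable F : finFieldType.
Local Notation Kinf := (laurent F).
Local Notation T := (uniformizer F).
Local Notation X := (Xinf F).
Implicit Types (g h k a b : GL2 F).

Lemma diag_mulE b q (A : 'M[Kinf]_(2, q)) i j : diagonalGL2 b ->
  (\val b *m A) i j = \val b i i * A i j.
Proof.
move=> /is_diag_mxP bd; rewrite mxE (bigD1 i) //= big1 ?addr0 // => l li.
by rewrite bd ?mul0r // eq_sym.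
Qed.

Lemma mul_diagE q (A : 'M[Kinf]_(q, 2)) b i j : diagonalGL2 b ->
  (A *m \val b) i j = A i j * \val b j j.
Proof.
move=> /is_diag_mxP bd; rewrite mxE (bigD1 j) //= big1 ?addr0 // => l lj.
by rewrite bd ?mulr0.
Qed.

Lemma diag_entryV b i : diagonalGL2 b -> \val b i i * \val (GL2inv b) i i = 1.
Proof.
by move=> bd; rewrite -diag_mulE // val_GL2inv (mulmxV (GL2_unit b)) mxE eqxx.
Qed.

Lemma diag_entry_neq0 b i : diagonalGL2 b -> \val b i i != 0.
Proof.
move=> /(diag_entryV i) bi; apply/eqP => b0; move: bi; rewrite b0 mul0r => /esym/eqP.
by rewrite oner_eq0.
Qed.

Lemma diagGL2M a b : diagonalGL2 a -> diagonalGL2 b -> diagonalGL2 (GL2mul a b).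
Proof.
move=> ad bd; apply/is_diag_mxP => i j ij; rewrite val_GL2mul diag_mulE //.
by have /is_diag_mxP -> := bd; rewrite ?mulr0.
Qed.

Lemma diagGL2V b : diagonalGL2 b -> diagonalGL2 (GL2inv b).
Proof.
move=> bd; apply/is_diag_mxP => i j ij.
apply: (mulfI (diag_entry_neq0 i bd)); rewrite mulr0 -diag_mulE //.
by rewrite val_GL2inv (mulmxV (GL2_unit b)) mxE (negPf (ij : i != j)).
Qed.

Lemma diag_det b : diagonalGL2 b -> \det (\val b) = \val b 0 0 * \val b 1 1.
Proof.
move=> /is_diag_mxP bd; rewrite det_trig; last first.
  by apply/is_trig_mxP => i j ij; rewrite bd // neq_ltn ij.
rewrite !big_ord_recl big_ord0 mulr1.
by congr (_ * \val b _ _); apply: val_inj.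
Qed.

(** The time of the diagonal flow: scalar matrices and the diagonal matrices with unit
    entries have weight 0, and the weight identifies the quotient with the integers. *)
Definition weight b : int := vval (\val b 0 0) - vval (\val b 1 1).

Lemma weightM a b : diagonalGL2 a -> diagonalGL2 b ->
  weight (GL2mul a b) = weight a + weight b.
Proof.
move=> ad bd; rewrite /weight !val_GL2mul !diag_mulE // !vvalM ?diag_entry_neq0 //.
by rewrite opprD addrACA.
Qed.

Lemma diag_vvalV b i : diagonalGL2 b ->
  vval (\val (GL2inv b) i i) = - vval (\val b i i).
Proof.
move=> bd; have [b0 bV0] := (diag_entry_neq0 i bd, diag_entry_neq0 i (diagGL2V bd)).
by apply: (addrI (vval (\val b i i))); rewrite subrr -(vvalM b0 bV0) diag_entryV ?vval1.
Qed.

Lemma weightV b : diagonalGL2 b -> weight (GL2inv b) = - weight b.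
Proof.
by move=> bd; rewrite /weight !diag_vvalV // opprB opprK addrC.
Qed.

Lemma scale_GL2 h (c : Kinf) : c != 0 -> exists h', \val h' = c *: \val h.
Proof.
move=> c0; have cu : c *: \val h \in unitmx by rewrite unitmxZ ?GL2_unit // unitfE.
by exists (mkGL2 cu).
Qed.

Lemma scale_diag b (c : Kinf) : diagonalGL2 b -> c != 0 ->
  exists b', [/\ diagonalGL2 b', weight b' = weight b & \val b' = c *: \val b].
Proof.
move=> bd c0; have [b' b'E] := scale_GL2 b c0.
exists b'; split; last exact: b'E.
  by apply/is_diag_mxP => l i li; rewrite b'E mxE; have /is_diag_mxP -> := bd; rewrite ?mulr0.
rewrite /weight b'E !mxE !vvalM ?diag_entry_neq0 //.
by rewrite opprD addrACA subrr add0r.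
Qed.

Lemma diag_pow_unit (j : int) : diag_mx (\row_i (if i == 0 :> 'I_2 then T ^ j else 1)) \in unitmx.
Proof.
rewrite unitmxE det_diag unitfE; apply/prodf_neq0 => i _; rewrite mxE.
by case: ifP => _; rewrite ?oner_neq0 // expfz_neq0 // uniformizer_neq0.
Qed.

Definition diag_pow (j : int) : GL2 F := mkGL2 (diag_pow_unit j).

Lemma diag_pow_diag j : diagonalGL2 (diag_pow j).
Proof. exact: diag_mx_is_diag. Qed.

Lemma weight_diag_pow j : weight (diag_pow j) = j.
Proof. by rewrite /weight /= !mxE /= !mulr1n vvalT vval1 subr0. Qed.

(** The points of the orbit of cls h at time j; they form a single orbit of the compact
    diagonal subgroup. *)
Definition slice (j : int) h : set X :=
  [set cls (GL2mul b h) | b in [set b | diagonalGL2 b /\ weight b = j]].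

Definition period (h : GL2 F) (P : int) :=
  exists b, [/\ diagonalGL2 b, weight b = P & cls (GL2mul b h) = cls h].

Lemma cls_mul b g h : cls g = cls h -> cls (GL2mul b g) = cls (GL2mul b h).
Proof. move=> /(congr1 (translate b)) gh.
exact (etrans (esym (translate_GL2mul b g)) (etrans gh (translate_GL2mul b h))). Qed.

Lemma A_orbitE h : A_orbit (cls h) = \bigcup_j slice j h.
Proof.
apply/seteqP; split=> [_ [a ad <-]|_ [j _ [b [bd _] <-]]].
  by exists (weight a); [exact: I | exists a; [split | rewrite translate_GL2mul]].
by exists b; [exact: bd | rewrite translate_GL2mul].
Qed.

Lemma slice_translate a j h : diagonalGL2 a ->
  translate a @^-1` slice (j + weight a) h = slice j h.
Proof.
move=> ad; apply/seteqP; split=> [x [b [bd bj]]|_ [b [bd bj] <-]]; last first.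
  exists (GL2mul a b); last by rewrite translate_GL2mul GL2mulA.
  by split; [exact: diagGL2M | rewrite (weightM ad bd) bj addrC].
have [g <-] : exists g, cls g = x by exists (repr x); exact: reprK.
rewrite translate_GL2mul => /(cls_mul (GL2inv a)); rewrite GL2mulVl => <-.
exists (GL2mul (GL2inv a) b); last by rewrite GL2mulA.
split; first exact: diagGL2M (diagGL2V ad) bd.
by rewrite (weightM (diagGL2V ad) bd) (weightV ad) bj addrC addrK.
Qed.

Lemma slice_period h P j : period h P -> slice j h `<=` slice (j + P) h.
Proof.
move=> [c [cd cP ch]] _ [b [bd bj] <-]; exists (GL2mul b c).
  by split; [exact: diagGL2M | rewrite (weightM bd cd) bj cP].
by rewrite -GL2mulA; exact: cls_mul.
Qed.

Lemma slice_meet h i j x : slice i h x -> slice j h x -> period h (j - i).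
Proof.
move=> [a [ad ai] <-] [b [bd bj]] /(cls_mul (GL2inv a)); rewrite GL2mulVl GL2mulA.
move=> ch; exists (GL2mul (GL2inv a) b); split; [exact: diagGL2M (diagGL2V ad) bd | | exact: ch].
by rewrite (weightM (diagGL2V ad) bd) (weightV ad) bj ai addrC.
Qed.

Lemma periodN h P : period h P -> period h (- P).
Proof.
move=> [c [cd cP ch]]; exists (GL2inv c); split; first exact: diagGL2V.
  by rewrite weightV ?cP.
by rewrite -[in RHS](GL2mulVl c h); apply: cls_mul.
Qed.

Lemma period0 h : period h 0.
Proof.
have [b bs] : exists b, slice 0 h (cls (GL2mul b h)).
  exists (diag_pow 0); exists (diag_pow 0) => //.
  by split; [exact: diag_pow_diag | exact: weight_diag_pow].
by have := slice_meet bs bs; rewrite subrr.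
Qed.

Lemma periodD h P Q : period h P -> period h Q -> period h (P + Q).
Proof.
move=> [a [ad aP ah]] [b [bd bQ bh]]; exists (GL2mul a b); split.
- exact: diagGL2M.
- by rewrite (weightM ad bd) aP bQ.
- by rewrite -GL2mulA -ah; apply: cls_mul.
Qed.

Lemma period_mul h P (n : int) : period h P -> period h (n * P).
Proof.
move=> hP; have hn (m : nat) : period h (P *+ m).
  by elim: m => [|m IH]; [exact: period0 | rewrite mulrS; exact: periodD].
have [m [->|->]] : exists m : nat, n = m%:Z \/ n = - m%:Z.
  by exists (absz n); case: (ltrP n 0) => n0; [right | left]; lia.
  by rewrite -[m%:Z]natz mulr_natl; exact: hn.
by rewrite mulNr -[m%:Z]natz mulr_natl; apply: periodN; exact: hn.
Qed.

(** Here the finiteness of the field of constants enters. *)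
Lemma bounded_mx_finite (N : nat) : exists s : seq 'M[{poly F}]_2,
  forall p : 'M[{poly F}]_2, (forall i j, (size (p i j) <= N)%N) -> p \in s.
Proof.
pose mx (f : {ffun 'I_2 * 'I_2 -> 'rV[F]_N}) : 'M[{poly F}]_2 :=
  \matrix_(i, j) rVpoly (f (i, j)).
exists (map mx (enum {ffun 'I_2 * 'I_2 -> 'rV[F]_N})) => p pN.
apply/mapP; exists [ffun ij => poly_rV (p ij.1 ij.2)]; first by rewrite mem_enum.
by apply/matrixP => i j; rewrite !mxE ffunE poly_rV_K.
Qed.

Lemma antitone_pigeonhole (S : eqType) (s : seq S) (Q : nat -> S -> Prop) :
  (forall m n x, (m <= n)%N -> Q n x -> Q m x) ->
  (forall m, exists2 x, x \in s & Q m x) -> exists x, forall m, Q m x.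
Proof.
move=> Qle; elim: s => [/(_ 0%N)[]//|y s IH] sQ.
have [|/existsNP[m nQ]] := pselect (forall m, Q m y); first by exists y.
apply: IH => n; have [x] := sQ (maxn m n); rewrite inE => /predU1P[-> |xs] Qx.
  by case: nQ; apply: Qle Qx; exact: leq_maxl.
by exists x => //; apply: Qle Qx; exact: leq_maxr.
Qed.

Lemma polyinf_det_neq0 (p : 'M[{poly F}]_2) : p \in unitmx ->
  \det (map_mx (@polyinf F) p) != 0.
Proof.
move=> up; rewrite det_map_mx polyinf_eq0.
by apply: contraTneq up => p0; rewrite unitmxE p0 unitr0.
Qed.

Lemma polyinf_unit_det (p : 'M[{poly F}]_2) : p \in unitmx ->
  vval (\det (map_mx (@polyinf F) p)) = 0.
Proof.
move=> up; rewrite det_map_mx vval_polyinf.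
  by move: up; rewrite unitmxE poly_unitE => /andP[/eqP -> _].
by rewrite -polyinf_eq0 -det_map_mx polyinf_det_neq0.
Qed.

Lemma ord2 (i : 'I_2) : i = 0 \/ i = 1.
Proof. by case: i => [[|[|//]] i2]; [left | right]; apply: val_inj. Qed.

Lemma near1_entry m k i : near1 m k -> exists2 f, f \is a GRing.unit & \val k i i = f%:F.
Proof.
move=> km; have : laurent_ge 1 (\val k i i - 1).
  by have := km i i; rewrite !mxE eqxx; apply: laurent_ge_le.
move=> [f fE]; exists (1 + psX F * f); last first.
  by rewrite tofracD tofracM tofrac1 -[LHS](subrK 1) fE expr1z addrC.
by rewrite ps_unitE pcoefD pcoef_psXM addr0 oner_neq0.
Qed.

(** Suppose that slice j h meets every neighborhood of cls h': then k h' = b h gamma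
    with k as close to 1 as desired and b of weight j. Comparing determinants fixes the
    valuations of the entries of b, which bounds the degrees in gamma. So finitely many
    gamma occur, one of them serves all k, and b tends to h' gamma^-1 h^-1, which is
    therefore diagonal and of weight j. *)
Lemma slice_closed j h : closed (slice j h).
Proof.
rewrite -openC; apply/Xinf_openP => h' nh'; apply: contrapT => /forallNP near.
pose Q m (p : 'M[{poly F}]_2) := p \in unitmx /\ exists k b,
  [/\ near1 m k, diagonalGL2 b, weight b = j &
      \val k *m \val h' = \val b *m (\val h *m map_mx (@polyinf F) p)].
have {}near m : exists p, Q m p.
  have /existsNP[k /not_implyP[km /contrapT]] := near m.
  move=> [b [bd bj] /clsP[c [p [c0 up kE]]]]; exists p; split=> //.
  have [b' [b'd b'w b'E]] := scale_diag bd c0.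
  exists k, b'; split; [exact: km | exact: b'd | by rewrite b'w |].
  by rewrite -val_GL2mul kE b'E -scalemxAl val_GL2mul; congr (_ *: _); rewrite mulmxA.
have [B QB] : exists B, forall m p, Q m p -> forall i l, (size (p i l) <= B)%N.
  have [c hc] := mx_ge_ex (\val (GL2inv h)); have [c' hc'] := mx_ge_ex (\val h').
  pose D := vval (\det (\val h')) - vval (\det (\val h)).
  exists (absz (c - (`|D| + `|j|) + c')).+1 => m p [up [k [b [km bd bj E]]]] i l.
  have bD : vval (\val b 0 0) + vval (\val b 1 1) = D.
    move/(congr1 (fun A => vval (\det A))): E; rewrite !det_mulmx.
    rewrite (diag_det bd) !vvalM ?mulf_neq0 ?GL2_det_neq0 ?diag_entry_neq0 //.
    - rewrite (integral_unit_det (near1_integral km)) polyinf_unit_det // add0r addr0.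
      by rewrite /D => ->; rewrite addrK.
    - exact: polyinf_det_neq0.
    - exact: polyinf_det_neq0.
  have bV : mx_ge (- (`|D| + `|j|)) (\val (GL2inv b)).
    move=> r t; have [<-|rt] := eqVneq r t.
      apply: laurent_ge_le (laurent_ge_vval _); rewrite diag_vvalV //.
      move: bD bj; rewrite /weight; case: (ord2 r) => ->; lia.
    by have /is_diag_mxP -> := diagGL2V bd; [exact: laurent_ge0 |].
  have pE : map_mx (@polyinf F) p = \val (GL2inv h) *m (\val (GL2inv b) *m (\val k *m \val h')).
    by rewrite E !val_GL2inv [X in _ *m X](mulKmx (GL2_unit b)) (mulKmx (GL2_unit h)).
  have kge := integral_unit_ge (near1_integral km).
  apply: polyinf_ge_size; have := mx_geM hc (mx_geM bV (mx_geM kge hc')).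
  rewrite -pE => /(_ i l); rewrite mxE; apply: laurent_ge_le; lia.
have [s sP] := bounded_mx_finite B.
have [p pQ] : exists p, forall m, Q m p.
  apply: (antitone_pigeonhole (s := s)) => [m n p mn [up [k [b [kn bd bj E]]]]|m].
    split; first exact: up.
    by exists k, b; split; [exact: near1_le mn kn | exact: bd | exact: bj | exact: E].
  have [p mp] := near m; exists p; last exact: mp.
  by apply: sP; exact: QB mp.
have uP : map_mx (@polyinf F) p \in unitmx
  by rewrite unitmxE unitfE; exact: polyinf_det_neq0 (pQ 0%N).1.
pose w := GL2mul (GL2mul h' (GL2inv (mkGL2 uP))) (GL2inv h).
have wE : \val h' = \val w *m \val h *m map_mx (@polyinf F) p.
  by rewrite -val_GL2mul GL2mulVr val_GL2mul val_GL2inv (mulmxKV uP).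
have kw m : exists k b, [/\ near1 m k, diagonalGL2 b, weight b = j &
    \val k *m \val w = \val b].
  have [_ [k [b [km bd bj E]]]] := pQ m; exists k, b; split; [exact: km|exact: bd|exact: bj|].
  move: E; rewrite wE !mulmxA => /(can_inj (mulmxK uP)).
  by move=> /(can_inj (mulmxK (GL2_unit h))).
have wd : diagonalGL2 w.
  apply/is_diag_mxP => i l il; have [c wc] := mx_ge_ex (\val w).
  apply: laurent_ge_eq0 => n.
  have [k [b [kn /is_diag_mxP bd _ E]]] := kw (absz (n - c)).
  have := mx_geN (mx_geM kn wc); rewrite mulmxBl mul1mx E opprB => /(_ i l).
  by rewrite !mxE bd // subr0; apply: laurent_ge_le; lia.
have ww : weight w = j.
  have [k [b [/near1_entry kn bd <- E]]] := kw 0%N; rewrite /weight -E !mul_diagE //.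
  have kv i : vval (\val k i i * \val w i i) = vval (\val w i i).
    have [f uf kf] := kn i.
    have k0 : \val k i i != 0.
      by rewrite kf tofrac_eq0; apply: contraTneq uf => ->; rewrite unitr0.
    by rewrite (vvalM k0 (diag_entry_neq0 i wd)) kf (vval_unit uf) add0r.
  by rewrite !kv.
apply: nh'; exists w; first by split.
apply/clsP; exists 1, p; split; [exact: oner_neq0 | exact: (pQ 0%N).1 |].
by rewrite scale1r val_GL2mul wE.
Qed.

End Slices.

(** * Invariant probability measures on the orbits *)

Section OrbitMeasure.
Variables (R : realType) (F : finFieldType).
Local Notation X := (borelX F).
Local Open Scope ereal_scope.

Lemma open_measurable_borelX (U : set (Xinf F)) : open U -> measurable (U : set X).
Proof. exact: sub_sigma_algebra. Qed.

Lemma slice_measurable j (h : GL2 F) : measurable (slice j h : set X).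
Proof.
rewrite -[slice j h]setCK; apply: measurableC; apply: open_measurable_borelX.
by rewrite openC; exact: slice_closed.
Qed.

Lemma measure_disjoint_family (mu : {measure set X -> \bar R}) (K : set X)
    (A : nat -> set X) (n : nat) : measurable K -> (forall i, measurable (A i)) ->
  (forall i, (i < n)%N -> K `&` A i = set0) ->
  (forall i j, (i < j < n)%N -> A i `&` A j = set0) ->
  mu (K `|` \big[setU/set0]_(i < n) A i) = mu K + \sum_(i < n) mu (A i).
Proof.
move=> mK mA; elim: n => [|n IH] KA AA; first by rewrite !big_ord0 setU0 adde0.
rewrite !big_ord_recr /= setUA measureU //; last 2 first.
- by apply: measurableU => //; exact: bigsetU_measurable.
- rewrite setIUl KA // set0U -bigcup_mkord setI_bigcupl.
  by apply: bigcup0 => i /= i_n; apply: AA; rewrite i_n ltnSn.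
rewrite addeA; congr (_ + _); apply: IH => [i i_n|i j /andP[ij jn]].
  by apply: KA; rewrite ltnW.
by apply: AA; rewrite ij ltnW.
Qed.

Section Invariant.
Variables (h : GL2 F) (mu : probability X R).
Hypothesis inv : A_orbit_measure (cls h) mu.

Lemma slice_measureE j : mu (slice j h) = mu (slice 0 h).
Proof.
have [_ minv] := inv.
rewrite -(minv _ (diag_pow_diag F j) _ (slice_measurable _ h)).
by have := slice_translate 0 h (diag_pow_diag F j); rewrite weight_diag_pow add0r => ->.
Qed.

Definition slice_mass : R := fine (mu (slice 0 h)).

Lemma slice_massE j : mu (slice j h) = slice_mass%:E.
Proof.
rewrite slice_measureE /slice_mass fineK // fin_num_measure //.
exact: slice_measurable.
Qed.

Lemma slice_mass_ge0 : (0 <= slice_mass)%R.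
Proof. by rewrite -lee_fin -(slice_massE 0) measure_ge0. Qed.

(** The orbit has mass 1 and is the union of countably many slices of equal mass. *)
Lemma slice_mass_gt0 : (0 < slice_mass)%R.
Proof.
rewrite lt_neqAle slice_mass_ge0 andbT; apply/eqP => e0.
have [/eqP] := inv; rewrite A_orbitE.
suff -> : mu (\bigcup_j slice j h) = 0 by rewrite eq_sym onee_eq0.
have -> : \bigcup_j slice j h = \bigcup_(n : nat) (slice n%:Z h `|` slice (- n%:Z) h).
  apply/seteqP; split=> [x [j _ xj]|x [n _ [xn|xn]]]; last 2 first.
  - by exists n%:Z.
  - by exists (- n%:Z)%R.
  by exists (absz j) => //; case: (ltrP j 0) => j0; [right | left];
    [rewrite ltz0_abs ?opprK | rewrite gez0_abs].
have mS n : measurable (slice n%:Z h `|` slice (- n%:Z) h : set X).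
  by apply: measurableU; exact: slice_measurable.
apply: measure_negligible; first exact: bigcupT_measurable.
have nS j : mu.-negligible (slice j h : set X).
  by apply/(negligibleP _ (slice_measurable j h)); have := slice_massE j; rewrite -e0.
by apply: negligible_bigcup => n; apply: negligibleU; exact: nS.
Qed.

Lemma disjoint_slices_mass (K : set X) (n : nat) : measurable K ->
  (forall i, (i < n)%N -> K `&` slice i%:Z h = set0) ->
  (forall P, (0 < P < n)%N -> ~ period h P%:Z) ->
  mu K + (slice_mass *+ n)%:E <= 1.
Proof.
move=> mK Kn nP.
have mA (i : nat) : measurable (slice i%:Z h : set X) by exact: slice_measurable.
have AA i j : (i < j < n)%N -> slice i%:Z h `&` slice j%:Z h = set0.
  move=> /andP[ij jn]; rewrite -subset0 => x [xi xj].
  apply: (nP (j - i)%N); first by rewrite subn_gt0 ij (leq_ltn_trans (leq_subr _ _) jn).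
  by rewrite -subzn 1?ltnW //; exact: slice_meet xi xj.
have mU : measurable (K `|` \big[setU/set0]_(i < n) slice i%:Z h : set X).
  by apply: measurableU => //; exact: bigsetU_measurable.
have := eq_ind _ (fun z => z <= 1) (probability_le1 mu mU) _
  (measure_disjoint_family mu mK mA Kn AA).
rewrite (eq_bigr (fun=> slice_mass%:E)) => [|i _]; last exact: slice_massE.
by rewrite sumEFin sumr_const card_ord.
Qed.

(** Without a period, infinitely many slices of the same positive mass are disjoint. *)
Lemma period_exists : exists2 P, (0 < P)%N & period h P%:Z.
Proof.
apply: contrapT => nP; have e0 := slice_mass_gt0.
have [N] : exists N : nat, (1 < slice_mass *+ N)%R.
  exists (Num.bound slice_mass^-1); rewrite -mulr_natr -ltr_pdivrMl // mulr1.
  by rewrite archi_boundP // invr_ge0 ltW.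
apply/negP; rewrite -leNgt -lee_fin.
rewrite -[leLHS]add0e -(measure0 mu); apply: disjoint_slices_mass => // [i _|P /andP[P0 _] hP].
  by rewrite set0I.
by apply: nP; exists P.
Qed.

Lemma period_mass P : (0 < P)%N -> period h P%:Z -> (1 <= slice_mass *+ P)%R.
Proof.
move=> P0 hP; rewrite -lee_fin.
have mA (i : nat) : measurable (slice i%:Z h : set X) by exact: slice_measurable.
have [<- _] := inv; rewrite A_orbitE.
have E : \bigcup_j slice j h = \big[setU/set0]_(i < P) slice i%:Z h.
  rewrite -(bigcup_mkord P (fun i : nat => slice i%:Z h));
  apply/seteqP; split=> [x [j _ xj]|x [i _ xi]]; last by exists i%:Z.
  have P0z : (P%:Z != 0)%R by rewrite eqz_nat -lt0n.
  exists (absz (j %% P)%Z) => /=; first by rewrite -ltz_nat gez0_abs ?modz_ge0 ?ltz_pmod.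
  rewrite gez0_abs ?modz_ge0 //.
  have -> : ((j %% P)%Z = j + (- (j %/ P)%Z) * P)%R by rewrite {2}(divz_eq j P) mulNr; ring.
  by apply: slice_period xj; exact: period_mul.
have mU : measurable (\big[setU/set0]_(i < P) slice i%:Z h : set X).
  by apply: bigsetU_measurable.
have := @content_subadditive _ _ _ mu _ (fun i => slice i%:Z h) P (fun k _ => mA k) mU
  (@subset_refl _ _).
rewrite E => /le_trans; apply.
rewrite (eq_bigr (fun=> slice_mass%:E)) => [|i _]; last exact: slice_massE.
by rewrite sumEFin sumr_const card_ord.
Qed.

(** Before the least period Q the slices are disjoint, and each has mass 1 / Q, which is
    at least 1 / P. If the first J of them avoid K, then K misses the proportion J / P
    of the orbit, or all of it when J exceeds Q. *)
Lemma escape_mass (K : set X) (c : R) (P J : nat) : measurable K ->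
  (0 < P)%N -> period h P%:Z -> (c <= 1)%R -> (c * P%:R <= J%:R)%R ->
  (forall i, (i < J)%N -> K `&` slice i%:Z h = set0) ->
  mu K <= (1 - c)%:E.
Proof.
move=> mK P0 hP c1 cP KJ.
have ex : exists Q, (0 < Q)%N && `[< period h Q%:Z >] by exists P; rewrite P0; apply/asboolP.
case: (ex_minnP ex) => Q /andP[Q0 /asboolP hQ] Qmin.
have QP : (Q <= P)%N by apply: Qmin; rewrite P0; apply/asboolP.
have nP S : (0 < S < Q)%N -> ~ period h S%:Z.
  move=> /andP[S0 SQ] hS; move: SQ; rewrite ltnNge Qmin // S0.
  exact/asboolP.
have eQ := period_mass Q0 hQ; have e0 := slice_mass_gt0.
suff [n [nQ nJ nc]] : exists n, [/\ (n <= Q)%N, (n <= J)%N & (c <= slice_mass *+ n)%R].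
  have Kn i : (i < n)%N -> K `&` slice i%:Z h = set0.
    by move=> i_n; apply: KJ; exact: leq_trans nJ.
  have nP' S : (0 < S < n)%N -> ~ period h S%:Z.
    by move=> /andP[S0 Sn]; apply: nP; rewrite S0 (leq_trans Sn).
  rewrite EFinB leeBrDr //; apply: le_trans (disjoint_slices_mass mK Kn nP').
  by rewrite leeD2l // lee_fin.
have [QJ|/ltnW JQ] := leqP Q J; first by exists Q; split=> //; exact: le_trans eQ.
exists J; split=> //; have [c0|/ltW c0] := leP c 0%R.
  by apply: le_trans c0 _; rewrite mulrn_wge0 ?ltW.
apply: (@le_trans _ _ (c * (slice_mass *+ Q))%R); first by rewrite ler_peMr.
rewrite -mulr_natr mulrCA -[leRHS]mulr_natr ler_wpM2l ?(ltW e0) //.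
by apply: le_trans cP; rewrite ler_wpM2l // ler_nat.
Qed.

End Invariant.
End OrbitMeasure.

(** * Lattices along a rational ray *)

Section RationalRay.
Variables (F : finFieldType) (nu : {poly F}).
Hypothesis nu_irr : irreducible_poly nu.
Local Notation Kinf := (laurent F).
Implicit Types (g h k b : GL2 F) (p M N : 'M[{poly F}]_2).

Local Notation inf_mx := (map_mx (@polyinf F)).

Lemma nu_neq0 : nu != 0.
Proof. exact: adic_nu_neq0. Qed.

(** In a compact part of the space the shortest vectors of a lattice are at least as
    long as the square root of the covolume, up to a constant: such a lattice is
    c k g F[Y]^2 with k in GL_2(F[[T]]), and F[Y]^2 is discrete. *)
Lemma orbit_vector_bound g : exists B : int, forall h, integral_orbit g (cls h) ->
  forall w : 'cV[{poly F}]_2, w != 0 ->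
  forall s : int, mx_ge s (\val h *m inf_mx w) -> s *+ 2 <= vval (\det (\val h)) + B.
Proof.
have [c gc] := mx_ge_ex (\val (GL2inv g)).
exists (- vval (\det (\val g)) - c *+ 2) => h [k ik /clsP[a [p [a0 up hE]]]] w w0 s hw.
have pw0 : p *m w != 0 by apply: contra_neq w0 => pw; rewrite -(mulKmx up w) pw mulmx0.
have pwE : inf_mx (p *m w) =
    \val (GL2inv g) *m (\val (GL2inv k) *m (a^-1 *: (\val h *m inf_mx w))).
  rewrite hE -scalemxAl scalerA mulVf // scale1r map_mxM val_GL2mul !val_GL2inv.
  rewrite -!mulmxA [X in _ = _ *m X](mulKmx (GL2_unit k)).
  by rewrite (mulKmx (GL2_unit g)).
have aV : laurent_ge (- vval a) a^-1 by rewrite -vvalV //; exact: laurent_ge_vval.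
have pwc := mx_geM gc (mx_geM (integral_unit_ge (integral_unitV ik)) (mx_geZ aV hw)).
rewrite -pwE in pwc.
have [i pwi] : exists i, (p *m w) i 0 != 0.
  apply: contrapT => /forallNP pw; case/eqP: pw0; apply/matrixP => i j.
  by rewrite ord1 [RHS]mxE; apply/eqP; apply: contrapT => /negP; exact: pw.
have s_le : c + (0 + (- vval a + s)) <= 0.
  rewrite leNgt; apply/negP => cs; case/eqP: pwi; apply: polyinf_ge1.
  by have := pwc i 0; rewrite mxE; apply: laurent_ge_le; lia.
have -> : vval (\det (\val h)) = vval a *+ 2 + vval (\det (\val g)).
  have [k0 g0 p0] := And3 (GL2_det_neq0 k) (GL2_det_neq0 g) (polyinf_det_neq0 up).
  rewrite hE detZ det_mulmx val_GL2mul det_mulmx.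
  rewrite (vvalM (expf_neq0 2 a0) (mulf_neq0 (mulf_neq0 k0 g0) p0)).
  rewrite (vvalX 2 a0) (vvalM (mulf_neq0 k0 g0) p0) (vvalM k0 g0).
  by rewrite integral_unit_det // polyinf_unit_det // add0r addr0.
by lia.
Qed.

Definition ray_mx n : 'M[{poly F}]_2 := diag_mx (\row_i nu ^+ (i * n)).

Lemma ray_mx_det n : \det (ray_mx n) = nu ^+ n.
Proof.
by rewrite det_diag !big_ord_recl big_ord0 !mxE /= mul0n mul1n expr0 mulr1 mul1r.
Qed.

Definition is_ray_lattice g n h := \val h = \val g *m inf_mx (ray_mx n).

Lemma ray_lattice_exists g n : exists h, is_ray_lattice g n h.
Proof.
have u : \val g *m inf_mx (ray_mx n) \in unitmx.
  rewrite unitmx_mul GL2_unit unitmxE unitfE det_map_mx polyinf_eq0 ray_mx_det.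
  by rewrite expf_neq0 // nu_neq0.
by exists (mkGL2 u).
Qed.

(** The vector g' e_1 belongs to the lattices of all n. Up to a common scalar, the
    diagonal flow does not lengthen it in positive time, while at time j the covolume is
    at least q^(n - j), up to a constant. *)
Lemma ray_cusp g' g : exists C : int, forall n h (j : nat), is_ray_lattice g' n h ->
  j%:Z < n%:Z - C -> integral_orbit g `&` slice j%:Z h = set0.
Proof.
have [B gB] := orbit_vector_bound g; have [c gc] := mx_ge_ex (\val g').
exists (B + vval (\det (\val g')) - c *+ 2) => n h j hn jn.
rewrite -subset0 => _ [/[swap] -[b [bd bj] <-]] /gB.
pose e1 : 'cV[{poly F}]_2 := \col_i (i == 0)%:R.
have e10 : e1 != 0.
  by apply/eqP => /matrixP/(_ 0 0)/eqP; rewrite !mxE oner_eq0.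
have De1 : ray_mx n *m e1 = e1.
  apply/matrixP => i l; rewrite mul_diag_mx !mxE.
  by case: (ord2 i) => ->; rewrite ?mulr0 // mul0n expr0 mulr1.
have e1ge : mx_ge 0 (inf_mx e1).
  move=> i l; rewrite !mxE; case: (i == 0).
    by rewrite rmorph1 -tofrac1; exact: laurent_ge_ps.
  by rewrite rmorph0; exact: laurent_ge0.
have bge : mx_ge (vval (\val b 1 1)) (\val b).
  move=> r t; have [<-|rt] := eqVneq r t.
    apply: laurent_ge_le (laurent_ge_vval _).
    by move: bj; rewrite /weight; case: (ord2 r) => ->; lia.
  by have /is_diag_mxP bd' := bd; rewrite (bd' r t rt); exact: laurent_ge0.
move=> /(_ e1 e10 (vval (\val b 1 1) + c)) bound.
have {}bound : (vval (\val b 1 1) + c) *+ 2 <= vval (\det (\val (GL2mul b h))) + B.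
  apply: bound; rewrite val_GL2mul hn -!mulmxA -map_mxM De1.
  by have := mx_geM bge (mx_geM gc e1ge); rewrite addr0.
have nuF : polyinf nu != 0 by rewrite polyinf_eq0 nu_neq0.
have nuv : vval (polyinf nu) <= -1.
  rewrite vval_polyinf ?nu_neq0 // lerN2 lez_nat.
  by move: nu_irr.1; case: (size nu) => [|[|]].
move: bound; rewrite val_GL2mul hn !det_mulmx (diag_det bd) det_map_mx ray_mx_det rmorphXn.
rewrite !vvalM ?mulf_neq0 ?diag_entry_neq0 ?GL2_det_neq0 ?expf_neq0 // vvalX //.
have : vval (polyinf nu) *+ n <= - n%:Z.
  by rewrite -mulr_natl natz; nia.
move: bj jn; rewrite /weight /= => bj jn nun bound; suff : False by [].
move: (_ *+ n) nun bound => z; move: (vval _) bj => v0 bj; move: (vval _) bj => v1 bj.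
move: (vval _) jn => v2 jn nun bound; clear -bj nun bound jn; lia.
Qed.

End RationalRay.

(** * Linear growth of the periods along a rational ray *)

Section Periods.
Variables (F : finFieldType) (nu : {poly F}).
Hypothesis nu_irr : irreducible_poly nu.
Local Notation Kinf := (laurent F).
Implicit Types (g h k b : GL2 F) (p M N : 'M[{poly F}]_2).

Local Notation inf_mx := (map_mx (@polyinf F)).

(** Matrices over the finite ring F[Y] / (nu) are finitely many. *)
Lemma polymx_power_congr1 p : p \in unitmx -> nu != 0 ->
  exists e M, (0 < e)%N /\ p ^+ e = 1 + nu *: M.
Proof.
move=> up nu0; pose f i := map_mx (fun x => x %% nu) (p ^+ i).
have [s sP] := bounded_mx_finite F (size nu).
have fs i : f i \in s by apply: sP => r t; rewrite mxE ltnW // ltn_modp.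
have /(uniqPn 0)[i [j [ij]]] : ~~ uniq (map f (iota 0 (size s).+1)).
  apply/negP => /uniq_leq_size /(_ (_ : {subset _ <= s})).
  rewrite size_map size_iota ltnn => H; suff : false by [].
  by apply: H => _ /mapP[l _ ->].
rewrite size_map size_iota => js.
rewrite !(nth_map 0%N) ?size_iota ?(ltn_trans ij) // !nth_iota ?(ltn_trans ij) // !add0n => fij.
pose M0 : 'M[{poly F}]_2 := \matrix_(r, t) ((p ^+ j - p ^+ i) r t %/ nu).
have M0E : p ^+ j - p ^+ i = nu *: M0.
  apply/matrixP => r t; have dv : nu %| (p ^+ j - p ^+ i) r t.
    have /matrixP/(_ r t) := fij; rewrite ![f _ r t]mxE => e.
    by rewrite /dvdp !mxE modpD modpN e subrr.
  by rewrite [RHS]mxE [M0 r t]mxE mulrC divpK.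
have ui : p ^+ i \is a GRing.unit by apply: unitrX.
exists (j - i)%N, ((p ^+ i)^-1 * M0); split; first by rewrite subn_gt0.
apply: (mulrI ui); rewrite -exprD subnKC 1?ltnW // mulrDr mulr1 -scalerAr mulrA.
by rewrite divrr // mul1r -M0E addrC subrK.
Qed.

(** In characteristic l, the power l^k of 1 + nu M is 1 modulo nu^(l^k): the exponent
    needed to be 1 modulo nu^n grows linearly in n. *)
Lemma polymx_frobenius M (l k : nat) : l \in [pchar F] ->
  (1 + nu *: M) ^+ (l ^ k) = 1 + nu ^+ (l ^ k) *: M ^+ (l ^ k).
Proof.
move=> lF.
have lM : l \in [pchar 'M[{poly F}]_2].
  have [lp /eqP l0] := andP lF; apply/andP; split=> //; apply/eqP.
  transitivity ((l%:R : F)%:P%:M : 'M[{poly F}]_2); first by rewrite !rmorph_nat.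
  by rewrite l0 polyC0 (rmorph0 (@scalar_mx _ _)).
rewrite -exprZn; elim: k => [|k IH]; first by rewrite !expr1.
rewrite expnSr !exprM IH -[LHS]/(pFrobenius_aut lM _) pFrobenius_autD_comm ?pFrobenius_aut1 //.
by apply: commr_sym; exact: commr1.
Qed.

(** The elements of the diagonal group that stabilize the class of h act on the lattice
    of h, once rescaled, through GL_2(F[Y]). *)
Lemma periodP h (P : int) : period h P <-> exists b p,
  [/\ diagonalGL2 b, weight b = P, p \in unitmx & \val b *m \val h = \val h *m inf_mx p].
Proof.
split=> [[b [bd bP /clsP[c [p [c0 up hE]]]]]|[b [p [bd bP up E]]]]; last first.
  exists b; split; [exact: bd | exact: bP | apply/clsP; exists 1, (invmx p)].
  split; [exact: oner_neq0 | by rewrite unitmx_inv |].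
  by rewrite scale1r val_GL2mul E -mulmxA -map_mxM mulmxV // map_mx1 mulmx1.
have [b' [b'd b'P b'E]] := scale_diag bd c0.
exists b', (invmx p); split; [exact: b'd | by rewrite b'P | by rewrite unitmx_inv |].
rewrite {2}hE b'E -!scalemxAl val_GL2mul; congr (_ *: _).
by rewrite -mulmxA -map_mxM (mulmxV up) map_mx1 mulmx1.
Qed.

Lemma intertwine_pow h b p (N : nat) : diagonalGL2 b ->
  \val b *m \val h = \val h *m inf_mx p -> exists b',
  [/\ diagonalGL2 b', weight b' = weight b *+ N &
      \val b' *m \val h = \val h *m inf_mx (p ^+ N)].
Proof.
move=> bd E; elim: N => [|N [b' [b'd b'w E']]].
  exists (diag_pow F 0); split; [exact: diag_pow_diag | exact: weight_diag_pow |].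
  rewrite expr0 map_mx1 mulmx1; apply/matrixP => i j.
  rewrite diag_mulE ?diag_pow_diag // mxE /= eqxx mxE.
  by rewrite expr0z if_same mulr1n mul1r.
exists (GL2mul b b'); split; first exact: diagGL2M.
  by rewrite weightM // b'w mulrS.
by rewrite val_GL2mul -mulmxA E' mulmxA E -mulmxA -map_mxM exprS.
Qed.

(** Matrices congruent to 1 modulo nu^n stabilize the sublattice diag(1, nu^n) F[Y]^2. *)
Lemma ray_conj M (n : nat) : exists M',
  (1 + nu ^+ n *: M) *m ray_mx nu n = ray_mx nu n *m (1 + M').
Proof.
exists (\matrix_(i, j) (nu ^+ (n - i * n) * M i j * nu ^+ (j * n))).
rewrite mulmxDl mulmxDr mul1mx mulmx1; congr (_ + _); apply/matrixP => i j.
rewrite mul_diag_mx mul_mx_diag !mxE mulrA; congr (_ * _).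
rewrite mulrA -exprD subnKC //.
by case: (ord2 i) => -> /=; rewrite ?mul0n ?mul1n.
Qed.

(** If b g = g c with c in GL_2(F[Y]) and c^e = 1 modulo nu, then c^(e l^k) is 1 modulo
    nu^(l^k), a congruence that survives conjugation by p. With the least power l^k
    above n, the element b^(e l^k) stabilizes the n-th lattice of the ray, and l^k is at
    most l n. The bound E is uniform in p, that is, in the rational end. *)
Lemma ray_period g (P0 : nat) : (0 < P0)%N -> period g P0%:Z ->
  exists2 E, (0 < E)%N & forall p h n, p \in unitmx -> (0 < n)%N ->
    \val h = \val g *m inf_mx (p *m ray_mx nu n) ->
    exists P, [/\ (0 < P)%N, (P <= E * n)%N & period h P%:Z].
Proof.
move=> P00 /periodP[b [c [bd bP uc bE]]].
have [e [M [e0 cE]]] := polymx_power_congr1 uc (nu_neq0 nu_irr).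
have [l lprime lF] := finPcharP F; have l1 := prime_gt1 lprime.
exists (P0 * e * l)%N => [|p h n up n0 hE]; first by rewrite !muln_gt0 P00 e0 ltnW.
pose k := (trunc_log l n).+1.
have nk : (n <= l ^ k)%N by rewrite ltnW // trunc_log_ltn.
have kn : (l ^ k <= l * n)%N by rewrite expnS leq_mul2l trunc_logP ?orbT.
exists (P0 * (e * l ^ k))%N; split.
- by rewrite !muln_gt0 P00 e0 expn_gt0 ltnW.
- by rewrite -!mulnA leq_mul2l leq_mul2l kn !orbT.
have [b' [b'd b'w b'E]] := intertwine_pow (e * l ^ k) bd bE.
have [M' M'E] := ray_conj (nu ^+ (l ^ k - n) *: (invmx p *m (M ^+ (l ^ k) *m p))) n.
have cpE : c ^+ (e * l ^ k) *m p =
    p *m (1 + nu ^+ n *: (nu ^+ (l ^ k - n) *: (invmx p *m (M ^+ (l ^ k) *m p)))).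
  rewrite exprM cE polymx_frobenius // scalerA -exprD subnKC //.
  rewrite mulmxDr mulmxDl mul1mx mulmx1; congr (_ + _).
  by rewrite -scalemxAr -scalemxAl mulKVmx.
have pR : c ^+ (e * l ^ k) *m (p *m ray_mx nu n) = p *m ray_mx nu n *m (1 + M').
  by rewrite mulmxA cpE -mulmxA M'E mulmxA.
apply/periodP; exists b', (1 + M'); split; [exact: b'd | | |].
- by rewrite b'w bP -mulr_natl natz -PoszM mulnC.
- have d0 : \det (p *m ray_mx nu n) != 0.
    rewrite det_mulmx ray_mx_det; apply: mulf_neq0.
      by apply/eqP => p0; move: up; rewrite unitmxE p0 unitr0.
    exact: expf_neq0 (nu_neq0 nu_irr).
  have : \det (c ^+ (e * l ^ k)) = \det (1 + M').
    have /(congr1 determinant) := pR; rewrite [LHS]det_mulmx [RHS]det_mulmx mulrC.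
    exact: (mulfI d0).
  by rewrite unitmxE => <-; rewrite -unitmxE; apply: (@unitrX _ c).
- by rewrite hE mulmxA b'E -mulmxA -map_mxM pR map_mxM mulmxA.
Qed.

End Periods.

(** * Rational points of the boundary *)

Section AdicIntegers.
Variables (F : finFieldType) (nu : {poly F}) (nu_irr : irreducible_poly nu).
Local Notation K := {fraction {poly F}}.
Local Notation Knu := (adic_completion nu_irr).
Local Notation CR := (cauchy_ring nu_irr).

Local Notation proj := (\pi_(adic_completion nu_irr)).

Lemma proj_eq (s t : CR) : proj s = proj t <-> adic_null nu (\val (s - t)).
Proof.
split=> [/eqP|st]; first by rewrite -subr_eq0 -rmorphB adic_pi_null => /asboolP.
by apply/eqP; rewrite -subr_eq0 -rmorphB adic_pi_null; apply/asboolP.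
Qed.

(** Replacing a Cauchy sequence by a tail turns a property of almost all of its terms
    into one of all of them, as the definition of adic_integer demands. *)
Lemma cauchy_shift (s : CR) (N : nat) :
  exists2 t : CR, proj t = proj s & forall i, \val t i = \val s (i + N)%N.
Proof.
have /asboolP sc := valP s.
have tc : (fun i => \val s (i + N)%N) \in cauchy_seqs nu_irr.
  apply/asboolP => n; have [M sM] := sc n; exists M => i j Mi Mj.
  by apply: sM; rewrite (leq_trans _ (leq_addr _ _)).
exists (cauchy_of tc) => //; apply/proj_eq => n.
have [M sM] := sc n; exists M => i Mi; rewrite rmorphB /=.
by apply: sM => //; rewrite (leq_trans _ (leq_addr _ _)).
Qed.

Lemma adic_integerD (x y : Knu) : adic_integer x -> adic_integer y -> adic_integer (x + y).
Proof.
move=> [s -> si] [t -> ti]; exists (s + t); first by rewrite rmorphD.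
by move=> i; rewrite rmorphD; exact: (adic_ge_add nu_irr (si i) (ti i)).
Qed.

Lemma adic_integerM (x y : Knu) : adic_integer x -> adic_integer y -> adic_integer (x * y).
Proof.
move=> [s -> si] [t -> ti]; exists (s * t); first by rewrite rmorphM.
by move=> i; rewrite rmorphM -[0%N]addn0; exact: (adic_ge_mul nu_irr (si i) (ti i)).
Qed.

Lemma adic_ge_poly (a : {poly F}) : adic_ge nu 0 a%:F.
Proof.
by exists a, 1; split; [exact: adic_ndvd1 | rewrite mul1r tofrac1 divr1].
Qed.

Lemma adic_integer_poly (a : {poly F}) : adic_integer (polynu nu_irr a).
Proof. by exists (adic_const nu_irr a%:F) => // i; exact: adic_ge_poly. Qed.

Fact polynu_zmod : zmod_morphism (polynu nu_irr).
Proof. by move=> a b; rewrite /polynu tofracB rmorphB. Qed.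
Fact polynu_monoid : monoid_morphism (polynu nu_irr).
Proof. by split=> [|a b]; rewrite /polynu ?tofrac1 ?rmorph1 // tofracM rmorphM. Qed.
HB.instance Definition _ :=
  GRing.isZmodMorphism.Build {poly F} Knu (polynu nu_irr) polynu_zmod.
HB.instance Definition _ :=
  GRing.isMonoidMorphism.Build {poly F} Knu (polynu nu_irr) polynu_monoid.

Lemma adic_ge_dvd (a : {poly F}) n : adic_ge nu n a%:F -> nu ^+ n %| a.
Proof.
move=> [c [b [nb E]]]; have b0 := adic_ndvd_neq0 nb.
have /eqP : (a * b)%:F = (nu ^+ n * c)%:F :> K by rewrite tofracM E divfK.
rewrite tofrac_eq => /eqP ab.
have : nu ^+ n %| a * b by rewrite ab dvdp_mulr.
by rewrite Gauss_dvdpl //; apply: coprimep_expl; exact: adic_coprime.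
Qed.

Lemma polynu_dvd (a : {poly F}) n (x : Knu) : adic_integer x ->
  polynu nu_irr a = polynu nu_irr nu ^+ n * x -> nu ^+ n %| a.
Proof.
move=> [s -> si] E; apply: adic_ge_dvd.
have /proj_eq/(_ n)[N sN] : proj (adic_const nu_irr a%:F) =
    proj (adic_const nu_irr (nu ^+ n)%:F * s).
  by rewrite rmorphM -[LHS]/(polynu nu_irr a) E -rmorphXn.
rewrite -(subrK ((nu ^+ n)%:F * \val s N) a%:F); apply: (adic_ge_add nu_irr).
  by have := sN N (leqnn N); rewrite rmorphB rmorphM.
rewrite -[n in adic_ge _ n _]addn0; apply: (adic_ge_mul nu_irr) => //.
by exists 1, 1; split; [exact: adic_ndvd1 | rewrite mulr1 tofrac1 divr1].
Qed.

(** The ring of nu-adic integers is local with maximal ideal generated by nu. *)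
Lemma adic_integerV (x : Knu) : adic_integer x ->
  ~ (exists2 b, adic_integer b & x = polynu nu_irr nu * b) ->
  x != 0 /\ adic_integer x^-1.
Proof.
move=> [s xs si] nx.
have x0 : x != 0.
  apply/eqP => x0; apply: nx; exists 0; last by rewrite x0 mulr0.
  by rewrite -(rmorph0 (polynu nu_irr)); exact: adic_integer_poly.
split=> //.
have /asboolP/(_ 1%N)[N sN] := valP s.
have sN1 i : (N <= i)%N -> ~ adic_ge nu 1 (\val s i).
  move=> Ni s1; apply: nx.
  have [t ts tE] := cauchy_shift s N.
  have t1 j : adic_ge nu 1 (\val t j).
    rewrite tE -(subrK (\val s i) (\val s _)); apply: (adic_ge_add nu_irr) => //.
    by apply: sN => //; rewrite leq_addl.
  have bc : (fun j => nu%:F^-1 * \val t j) \in cauchy_seqs nu_irr.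
    apply/asboolP => n; have /asboolP/(_ n.+1)[M tM] := valP t.
    exists M => j l Mj Ml; apply: (@adic_shift _ _ nu_irr 1); rewrite addn1 expr1.
    by rewrite -mulrBr mulVKf ?adic_nuF_neq0 //; exact: tM.
  exists (proj (cauchy_of bc)).
    exists (cauchy_of bc) => // j; apply: (@adic_shift _ _ nu_irr 1).
    by rewrite expr1 /= mulVKf ?adic_nuF_neq0 //; exact: t1.
  rewrite xs -ts /polynu /adic_embed -rmorphM; congr (proj _).
  apply: val_inj; rewrite rmorphM; apply/funext => j.
  by rewrite -[RHS]/(nu%:F * (nu%:F^-1 * \val t j)) mulVKf // adic_nuF_neq0.
have [t xt] : exists t, x^-1 = proj t by exists (repr x^-1); rewrite reprK.
have /proj_eq/(_ 1%N)[M stM] : proj (s * t) = proj 1.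
  by rewrite rmorphM rmorph1 -[RHS](mulfV x0) xt xs.
have [t' tt' t'E] := cauchy_shift t (maxn M N).
exists t'; first by rewrite tt'.
move=> i; rewrite t'E; set l := (i + _)%N.
have [Ml Nl] : (M <= l)%N /\ (N <= l)%N.
  by split; apply: leq_trans (leq_addl _ _); [exact: leq_maxl | exact: leq_maxr].
have [a [b [nb sE]]] := si l; rewrite expr0 mul1r in sE.
have na : ~~ (nu %| a).
  apply/negP => /dvdpP[a' aE]; apply: (sN1 l Nl); exists a', b; split=> //.
  by rewrite sE aE expr1 [nu * _]mulrC.
have s0 : \val s l != 0.
  rewrite sE; apply: mulf_neq0; first exact: (adic_ndvd_neq0 na).
  by rewrite invr_eq0; exact: (adic_ndvd_neq0 nb).
rewrite -(mulKf s0 (\val t l)) -[0%N]addn0; apply: (adic_ge_mul nu_irr).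
  by exists b, a; split=> //; rewrite sE invf_div expr0 mul1r.
rewrite -(subrK 1 (_ * _)); apply: (adic_ge_add nu_irr).
  by have := stM l Ml; rewrite rmorphB rmorphM rmorph1; apply: adic_ge_le.
by have := adic_ge_poly 1; rewrite tofrac1.
Qed.

End AdicIntegers.

Section RationalEnds.
Variables (F : finFieldType) (nu : {poly F}) (nu_irr : irreducible_poly nu).
Local Notation K := {fraction {poly F}}.
Local Notation Knu := (adic_completion nu_irr).
Local Notation inf_mx := (map_mx (@polyinf F)).
Local Notation emb := (polynu nu_irr).

(** Clearing denominators and common factors leaves a scalar c. Coprime coordinates are
    not both divisible by nu, so c is a nu-adic unit when u is primitive. *)
Lemma rational_coprime_coordinates (u : 'cV[Knu]_2) :
  primitive_vec u -> K_rational u ->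
  exists c a0 a1 s t, [/\ c != 0 /\ adic_integer c^-1, s * a0 + t * a1 = 1,
    u 0 0 = c * emb a0 & u 1 0 = c * emb a1].
Proof.
move=> [uO unu] [c [w [c0 uE]]].
have [b0 [d0 [d00 w0E]]] := fraction_polyE (w 0 0).
have [b1 [d1 [d10 w1E]]] := fraction_polyE (w 1 0).
pose g := gcdp (b0 * d1) (b1 * d0).
have g0 : g != 0.
  apply/negP; rewrite gcdp_eq0 !mulf_eq0 (negPf d00) (negPf d10) !orbF => /andP[/eqP b00 /eqP b10].
  apply: unu => i; exists 0.
    by rewrite -(rmorph0 emb); exact: adic_integer_poly.
  rewrite uE !mxE; case: (ord2 i) => ->; rewrite ?w0E ?w1E ?b00 ?b10 tofrac0 mul0r.
    by rewrite rmorph0 !mulr0.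
  by rewrite rmorph0 !mulr0.
pose a0 := (b0 * d1) %/ g; pose a1 := (b1 * d0) %/ g.
have b0E : b0 * d1 = a0 * g by rewrite divpK // dvdp_gcdl.
have b1E : b1 * d0 = a1 * g by rewrite divpK // dvdp_gcdr.
have /Bezout_eq1_coprimepP[[s t] /= st] : coprimep a0 a1.
  by apply: coprimep_div_gcd; apply: contraNT g0;
     rewrite negb_or !negbK => /andP[/eqP b00 /eqP b10];
     rewrite /g b00 b10 gcdp0.
pose c' := c * adic_embed nu_irr (g%:F / (d0 * d1)%:F).
have fracE (b d d' a : {poly F}) : d != 0 -> d' != 0 -> b * d' = a * g ->
    b%:F / d%:F = g%:F / (d * d')%:F * a%:F :> K.
  rewrite -!(@tofrac_eq0 {poly F}) tofracM => dF dF' /(congr1 (@FracField.tofrac _)).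
  rewrite !tofracM; move: b%:F d%:F d'%:F a%:F g%:F dF dF' => B D D' A G D0 D'0 E.
  by rewrite mulrAC [G * A]mulrC -E invfM mulrACA divff // mulr1.
have u0 : u 0 0 = c' * emb a0.
  by rewrite uE !mxE w0E (fracE _ _ d1 a0) // rmorphM mulrA.
have u1 : u 1 0 = c' * emb a1.
  by rewrite uE !mxE w1E (fracE _ _ d0 a1) // [d1 * d0]mulrC rmorphM mulrA.
exists c', a0, a1, s, t; split; [apply: adic_integerV | exact: st | exact: u0 | exact: u1].
  have -> : c' = emb s * u 0 0 + emb t * u 1 0.
    by rewrite u0 u1 !(mulrCA _ c') -mulrDr -!rmorphM -rmorphD st rmorph1 mulr1.
  by apply: adic_integerD; apply: adic_integerM => //; exact: adic_integer_poly.
move=> [b bO c'E]; apply: unu => i; case: (ord2 i) => ->; rewrite ?u0 ?u1 c'E.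
  by exists (b * emb a0); rewrite ?mulrA //; apply: adic_integerM => //; exact: adic_integer_poly.
by exists (b * emb a1); rewrite ?mulrA //; apply: adic_integerM => //; exact: adic_integer_poly.
Qed.

(** By Bezout, coprime coordinates are the first column of a matrix p in GL_2(F[Y]).
    In the basis of its columns, the congruence that defines L_n says that the second
    coordinate is divisible by nu^n. *)
Lemma line_lattice_rational (u : 'cV[Knu]_2) : primitive_vec u -> K_rational u ->
  exists2 p : 'M[{poly F}]_2, p \in unitmx &
    forall n, line_lattice u n = [set p *m ray_mx nu n *m v | v in setT].
Proof.
move=> up uK; have [c [a0 [a1 [s [t [[c0 cV] st u0 u1]]]]]] := rational_coprime_coordinates up uK.
pose p : 'M[{poly F}]_2 :=
  \matrix_(i, j) if j == 0 then (if i == 0 then a0 else a1) else (if i == 0 then - t else s).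
pose q : 'M[{poly F}]_2 :=
  \matrix_(i, j) if i == 0 then (if j == 0 then s else t) else (if j == 0 then - a1 else a0).
have sum2 (R : nmodType) (f : 'I_2 -> R) : \sum_i f i = f 0 + f 1.
  by rewrite !big_ord_recl big_ord0 addr0; congr (_ + f _); apply: val_inj.
have alg (R : comPzRingType) (N A0 A1 x y W0 W1 : R) :
    - A1 * (x * (y * A0) + N * W0) + A0 * (x * (y * A1) + N * W1) =
    N * (- A1 * W0 + A0 * W1) by ring.
have qp : q *m p = 1%:M.
  apply/matrixP => i j; rewrite !mxE sum2 !mxE.
  by case: (ord2 i) => ->; case: (ord2 j) => ->; rewrite /= -?st; ring.
have pq : p *m q = 1%:M by apply: mulmx1C.
have pu : p \in unitmx by case/mulmx1_unit: pq.
exists p => // n; apply/seteqP; split=> [v [a [w [aO wO vE]]]|_ [v _ <-]].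
  have [y yE] : exists y, y = q *m v by exists (q *m v).
  have y1 : emb (y 1 0) = emb nu ^+ n * (- emb a1 * w 0 0 + emb a0 * w 1 0).
    have v0 : emb (v 0 0) = a * (c * emb a0) + emb nu ^+ n * w 0 0.
      by have /matrixP/(_ 0 0) := vE; rewrite !mxE u0.
    have v1 : emb (v 1 0) = a * (c * emb a1) + emb nu ^+ n * w 1 0.
      by have /matrixP/(_ 1 0) := vE; rewrite !mxE u1.
    have -> : y 1 0 = - a1 * v 0 0 + a0 * v 1 0 by rewrite yE mxE sum2 !mxE.
    rewrite rmorphD !rmorphM rmorphN /= v0 v1.
    exact: alg.
  have /dvdpP[z zE] : nu ^+ n %| y 1 0.
    apply: (polynu_dvd _ y1); apply: adic_integerD; apply: adic_integerM => //.
      by rewrite -rmorphN; exact: adic_integer_poly.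
    exact: adic_integer_poly.
  exists (\col_i if i == 0 then y 0 0 else z) => //.
  rewrite -[RHS]mul1mx -pq -!mulmxA; congr (_ *m _); rewrite -yE.
  apply/matrixP => i j; rewrite mul_diag_mx !mxE ord1.
  by case: (ord2 i) => -> /=; rewrite ?mul0n ?mul1n ?expr0 ?mul1r // zE mulrC.
exists (emb (v 0 0) * c^-1), (\col_i (emb (p i 1) * emb (v 1 0))); split.
- by apply: adic_integerM => //; exact: adic_integer_poly.
- by move=> i; rewrite mxE; apply: adic_integerM; exact: adic_integer_poly.
have alg' (A x P N y : Knu) : A * x + P * (N * y) = x * c^-1 * (c * A) + N * (P * y).
  by rewrite [x * _ * _]mulrA (divfK c0) [x * A]mulrC mulrCA.
apply/matrixP => i j; rewrite ord1 -mulmxA mxE [X in emb X]mxE sum2 mul_diag_mx.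
have uE : u i 0 = c * emb (p i 0).
  by rewrite mxE; case: (ord2 i) => ->; rewrite ?u0 ?u1.
rewrite [in RHS]mxE [X in _ = X + _]mxE uE [X in _ = _ + X]mxE [X in _ = _ + _ * X]mxE.
rewrite [(\matrix_(_, _) _) 0 0]mxE [(\matrix_(_, _) _) 1 0]mxE !mxE mul0n mul1n expr0 mul1r.
by rewrite rmorphD !rmorphM rmorphXn; exact: alg'.
Qed.

Lemma lattice_of_inj (h h' : GL2 F) : lattice_of h setT = lattice_of h' setT -> cls h = cls h'.
Proof.
have basis_change (a b : GL2 F) : lattice_of a setT `<=` lattice_of b setT ->
    exists p, \val b *m inf_mx p = \val a.
  move=> ab.
  have /choice[f fE] : forall j : 'I_2, exists v : 'cV_2, \val b *m inf_mx v = col j (\val a).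
    move=> j; have [|v _ vE] := ab (\val a *m inf_mx (delta_mx j 0)).
      by exists (delta_mx j 0).
    by exists v; rewrite vE map_delta_mx colE.
  exists (\matrix_(i, j) f j i 0); apply/matrixP => i j.
  have /matrixP/(_ i 0) := fE j; rewrite !mxE => <-.
  by apply: eq_bigr => l _; rewrite !mxE.
move=> hh'.
have [p pE] : exists p, \val h *m inf_mx p = \val h' by apply: basis_change; rewrite hh'.
have [q qE] : exists q, \val h' *m inf_mx q = \val h by apply: basis_change; rewrite hh'.
apply/clsP; exists 1, p; split; [exact: oner_neq0 | | by rewrite scale1r pE].
have : inf_mx (p *m q) = 1%:M.
  apply: (can_inj (mulKmx (GL2_unit h))).
  by rewrite map_mxM mulmxA pE qE mulmx1.
rewrite -(map_mx1 (@polyinf F)) => /matrixP pq.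
have /mulmx1_unit[] // : p *m q = 1%:M.
by apply/matrixP => i j; apply: polyinf_inj; have := pq i j; rewrite !mxE.
Qed.

Lemma rational_ray g (u : 'cV[Knu]_2) : primitive_vec u -> K_rational u ->
  exists2 p : 'M[{poly F}]_2, p \in unitmx & forall n x h,
    represents x (lattice_of g (line_lattice u n)) ->
    \val h = \val g *m inf_mx (p *m ray_mx nu n) -> x = cls h.
Proof.
move=> up uK; have [p pu pE] := line_lattice_rational up uK.
exists p => // n x h [g1 -> g1E] hE; apply: lattice_of_inj; rewrite -g1E pE.
apply/seteqP; split=> [_ [_ [v _ <-] <-]|_ [v _ <-]].
  by exists v; rewrite // map_mxM mulmxA -hE.
by exists (p *m ray_mx nu n *m v); [exists v | rewrite map_mxM mulmxA -hE].
Qed.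

End RationalEnds.

(** * Weak-star limits and the escape of mass *)

Section Exhaustion.
Variable F : finFieldType.
Local Notation X := (Xinf F).

(** The matrices of polynomials in T that serve as representatives are countably
    many. *)
Lemma integral_orbit_countable : exists O : nat -> set X,
  (forall x, exists i, O i x) /\
  (forall i, O i = set0 \/ exists g, O i = integral_orbit g).
Proof.
pose rep (p : 'M[{poly F}]_2) (h : GL2 F) := \val h = ps_mx (map_mx (@ps_of_poly F) p).
pose O i : set X := if (unpickle i : option 'M[{poly F}]_2) is Some p then
  [set x | exists2 h, rep p h & integral_orbit h x] else set0.
exists O; split=> [x|i].
  have [p pu px] := integral_orbit_poly x; exists (pickle p).
  by rewrite /O pickleK; exists (mkGL2 pu); [| exact: px].
rewrite /O; case: (unpickle i) => [p|]; last by left.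
have [[h hp]|np] := pselect (exists h, rep p h); last first.
  by left; rewrite -subset0 => x [h hp _]; apply: np; exists h.
right; exists h; apply/seteqP; split=> [x [h' h'p]|x hx]; last by exists h.
by rewrite (_ : h' = h) //; apply: val_inj; exact: etrans h'p (esym hp).
Qed.

Variables (O : nat -> set X).
Hypothesis OE : forall i, O i = set0 \/ exists g, O i = integral_orbit g.

Definition exhaust N : set X := \big[setU/set0]_(i < N) O i.

Lemma exhaust_compact N : compact (exhaust N).
Proof.
apply: bigsetU_compact => i _; case: (OE i) => [->|[g ->]]; first exact: compact0.
exact: integral_orbit_compact.
Qed.

Lemma exhaust_invariant N : integral_invariant (exhaust N).
Proof.
move=> k h ik; rewrite /exhaust -!bigcup_mkord => -[i iN Oi]; exists i => //.
have [E|[g E]] := OE i; first by move: Oi; rewrite E.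
by rewrite E; apply: integral_orbit_invariant => //; rewrite -E.
Qed.

Lemma exhaust_measurable N : measurable (exhaust N : set (borelX F)).
Proof.
apply: open_measurable_borelX; apply: integral_invariant_open.
exact: exhaust_invariant.
Qed.

Lemma invariant_indic_continuous (R : realType) (U : set X) :
  integral_invariant U -> continuous (\1_U : X -> R).
Proof.
move=> Ui x; apply: (@cvg_near_cst _ R _ _ (nbhs x) (nbhs_filter x)).
have [Ux|nUx] := pselect (U x).
  have : nbhs x U by apply: open_nbhs_nbhs; split=> //; exact: integral_invariant_open.
  by apply: (@filterS _ (nbhs x) _) => y Uy; rewrite !indicE !mem_set.
have : nbhs x (~` U).
  apply: open_nbhs_nbhs; split=> //.
  exact/integral_invariant_open/integral_invariantC.
by apply: (@filterS _ (nbhs x) _) => y nUy; rewrite !indicE !memNset.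
Qed.

Lemma exhaust_Cc (R : realType) N : continuous (\1_(exhaust N) : X -> R) /\
  compact (closure [set x | (\1_(exhaust N) : X -> R) x != 0]).
Proof.
split; first by apply: invariant_indic_continuous; exact: exhaust_invariant.
have -> : [set x | (\1_(exhaust N) : X -> R) x != 0] = exhaust N.
  apply/seteqP; split=> x /=; rewrite indicE; last by move=> xN; rewrite mem_set // oner_neq0.
  by case: (boolP (x \in exhaust N)) => [/set_mem //|_]; rewrite eqxx.
have /closure_id <- : closed (exhaust N).
  by apply: integral_invariant_closed; exact: exhaust_invariant.
exact: exhaust_compact.
Qed.

End Exhaustion.

Section Accumulation.
Variables (R : realType) (F : finFieldType).
Local Notation X := (borelX F).

Lemma pairing_indic (theta : {measure set X -> \bar R}) (U : set X)
    (UC : continuous (\1_U : Xinf F -> R) /\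
      compact (closure [set x : Xinf F | (\1_U : Xinf F -> R) x != 0])) :
  measurable U -> pairing theta (exist _ (\1_U : Xinf F -> R) UC) = fine (theta U).
Proof.
by move=> mU; rewrite /pairing /Rintegral /= integral_indic // setIT.
Qed.

(** Evaluation at i is continuous for pointwise convergence. *)
Lemma accumulation_le (I : Type) (phi : nat -> {ptws I -> R}) (psi : {ptws I -> R})
    (i : I) (c : R) : cluster (phi @ \oo) psi ->
  (\forall n \near \oo, phi n i <= c) -> psi i <= c.
Proof.
move=> cl phic; apply/ler_addgt0Pr => e e0.
have [f [/= fc fe]] := cl [set f | f i <= c] [set f | `|psi i - f i| < e] phic
  (@proj_continuous {classic I} (fun=> R) i psi _ (nbhsx_ballx (psi i) e e0)).
by rewrite -lerBlDl; apply: le_trans (ltW fe); apply: le_trans (ler_norm _); rewrite lerB.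
Qed.

Lemma escape_of_exhaustion (O : nat -> set (Xinf F)) (mu : nat -> probability X R)
    (theta : {measure set X -> \bar R}) (c : R) :
  (forall x, exists i, O i x) ->
  (forall i, O i = set0 \/ exists g, O i = integral_orbit g) ->
  (forall N, \forall n \near \oo, (mu n (exhaust O N) <= c%:E)%E) ->
  radon theta -> weak_star_accumulation mu theta -> (theta setT <= c%:E)%E.
Proof.
move=> Ocover OE muO rad acc.
have mK N := exhaust_measurable OE N.
have thK N : (theta (exhaust O N) <= c%:E)%E.
  have fin : theta (exhaust O N) \is a fin_num.
    by rewrite ge0_fin_numE ?measure_ge0 //; apply: rad; exact: exhaust_compact.
  rewrite -(fineK fin) lee_fin -(pairing_indic theta (exhaust_Cc OE R N)) //.
  apply: (accumulation_le acc); near=> n.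
  rewrite pairing_indic // -lee_fin fineK ?fin_num_measure //.
  by near: n; exact: muO.
have cover : \bigcup_N exhaust O N = setT.
  rewrite -subTset => x _; have [i xi] := Ocover x; exists i.+1 => //.
  by rewrite /exhaust -bigcup_mkord; exists i => /=.
have ndK : nondecreasing_seq (fun N => exhaust O N).
  move=> n m nm; apply/subsetPset; rewrite /exhaust -!bigcup_mkord => x [i i_n xi].
  by exists i => //=; exact: leq_trans i_n nm.
have := @nondecreasing_cvg_mu _ _ _ theta (exhaust O) mK (bigcupT_measurable _ mK) ndK.
rewrite cover => /cvg_lim <- //; apply: lime_le.
  apply: ereal_nondecreasing_is_cvgn => n m nm; rewrite /= le_measure ?inE //.
  exact/subsetPset/ndK.
by near=> n; exact: thK.
Unshelve. all: by end_near. Qed.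

End Accumulation.

Section Conclusion.
Variables (R : realType) (F : finFieldType) (nu : {poly F}).
Hypothesis nu_irr : irreducible_poly nu.
Local Notation inf_mx := (map_mx (@polyinf F)).

(** The period is at most E n and the first n - L slices avoid the compact set, which is
    at least half of n of them once n > 2 L: hence the proportion 1 / (2 E). *)
Lemma ray_exhaust_mass (O : nat -> set (Xinf F)) (g' : GL2 F) (E N : nat) :
  (forall i, O i = set0 \/ exists g, O i = integral_orbit g) -> (0 < E)%N ->
  exists n0, forall n h (mu : probability (borelX F) R), (n0 <= n)%N ->
    is_ray_lattice nu g' n h ->
    (exists P, [/\ (0 < P)%N, (P <= E * n)%N & period h P%:Z]) ->
    A_orbit_measure (cls h) mu ->
    (mu (exhaust O N) <= (1 - (E * 2)%:R^-1)%:E)%E.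
Proof.
move=> OE E0.
have [L LP] : exists L : nat, forall i n h (j : nat), (i < N)%N -> is_ray_lattice nu g' n h ->
    (j < n - L)%N -> O i `&` slice j%:Z h = set0.
  elim: N => [|N [L LP]]; first by exists 0%N.
  have [C CP] : exists C : int, forall n h (j : nat), is_ray_lattice nu g' n h ->
      j%:Z < n%:Z - C -> O N `&` slice j%:Z h = set0.
    have [ON|[g ->]] := OE N; last exact: ray_cusp.
    by exists 0 => *; rewrite ON set0I.
  exists (maxn L `|C|) => i n h j; rewrite ltnS leq_eqVlt => /predU1P[->|iN] hn jn.
    by apply: (CP n) => //; move: (leq_maxr L `|C|) jn; lia.
  by apply: (LP i n) => //; move: (leq_maxl L `|C|) jn; lia.
exists (2 * L).+1 => n h mu n0 hn [P [P0 PE hP]] inv.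
have E2 : 0 < (E * 2)%:R :> R by rewrite ltr0n muln_gt0 E0.
apply: (escape_mass (P := P) (J := n - L) inv) => //.
- exact: exhaust_measurable.
- by rewrite invf_le1 // ler1n muln_gt0 E0.
- rewrite ler_pdivrMl // -natrM ler_nat (leq_trans PE) // -mulnA leq_mul2l.
  by apply/orP; right; lia.
- move=> j jn; rewrite /exhaust -bigcup_mkord setI_bigcupl; apply: bigcup0 => i /= iN.
  exact: (LP i n).
Qed.

End Conclusion.

Theorem theorem1 (R : realType) (F : finFieldType) (nu : {poly F})
    (nu_irr : irreducible_poly nu) (x0 : Xinf F) (x0_periodic : A_periodic x0) :
  exists c : R, 0 < c /\
    forall xi : set (nat -> Xinf F), Omega nu x0 xi ->
      rational_end nu_irr x0 xi -> uniform_escape c x0 xi.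
Proof.
have [g0 g0x] : exists g0, cls g0 = x0 by exists (repr x0); exact: reprK.
have [[P0 P00 g0P0]|aper] := pselect (exists2 P, (0 < P)%N & period g0 P%:Z); last first.
  exists 1; split=> // xi _ _ theta [_ [x [mu [_ xx0 muP _]]]]; case: aper.
  by apply: (period_exists (mu := mu 0%N)); rewrite g0x -xx0; exact: muP.
have [E E0 EP] := ray_period nu_irr P00 g0P0.
have [U [Ocover OE]] := integral_orbit_countable F.
exists (E * 2)%:R^-1; split; first by rewrite invr_gt0 ltr0n muln_gt0 E0.
move=> xi _ [g [u [x0g up uK [r rP xiE]]]] theta [rad [x [mu [xix _ muP acc]]]].
have [p pu pP] := rational_ray g up uK.
(* The representative g comes with the end; it is compared with g0, on which E depends. *)
have [a [d [a0 du gE]]] : exists (a : laurent F) (d : 'M[{poly F}]_2),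
    [/\ a != 0, d \in unitmx & \val g = a *: (\val g0 *m map_mx (@polyinf F) d)].
  by apply/clsP; rewrite g0x.
have dpu : d *m p \in unitmx by rewrite unitmx_mul du.
have u' : map_mx (@polyinf F) (d *m p) \in unitmx.
  by rewrite unitmxE unitfE; exact: polyinf_det_neq0.
pose g' := GL2mul g0 (mkGL2 u').
have g'E n h : is_ray_lattice nu g' n h ->
    \val h = \val g0 *m map_mx (@polyinf F) (d *m p *m ray_mx nu n).
  by rewrite /is_ray_lattice val_GL2mul -mulmxA -map_mxM.
have rE n h : is_ray_lattice nu g' n h -> r n = cls h.
  move=> /g'E hE; have [h1 h1E] := scale_GL2 h a0.
  have -> : cls h = cls h1.
    apply/clsP; exists a, 1%:M; split; [exact: a0 | exact: unitmx1 |].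
    by rewrite h1E map_mx1 mulmx1.
  apply: (pP n) => //; rewrite h1E hE gE -scalemxAl; congr (_ *: _).
  by rewrite -[RHS]mulmxA -map_mxM mulmxA.
move: xix; rewrite xiE => -[_ [k [l xr]]].
apply: (escape_of_exhaustion Ocover OE _ rad acc) => N.
have [n0 n0P] := ray_exhaust_mass R nu_irr g' N OE E0.
near=> n.
have nl : (n0.+1 + l <= n)%N by near: n; exists (n0.+1 + l)%N.
have [h hn] := ray_lattice_exists nu_irr g' (n - l + k)%N.
apply: (n0P (n - l + k)%N h) => //; first by lia.
  apply: (EP (d *m p) h) => //; [by lia | exact: g'E].
by rewrite -(rE _ _ hn) xr subnK ?muP //; lia.
Unshelve. all: by end_near. Qed.
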